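(* Let $\mathcal{P}, \mathcal{Q} \in \mathcal{S}_{\alpha}^{\mathbf{k}}$. If $p = (\lambda, \mathbf{u}_{1}, \dots, \mathbf{u}_d) \in \otimes^{-1}(\mathcal{P})$ and $q = (\mu, \mathbf{v}_{1}, \dots, \mathbf{v}_{d}) \in \otimes^{-1}(\mathcal{Q})$ are matched, $\alpha$-compatible representatives, then $$\operatorname{dist}_{\mathcal{S}_{\alpha}^{\mathbf{k}}}(\mathcal{P}, \mathcal{Q}) = \operatorname{dist}_{\mathcal{P}_{\alpha}^{\mathbf{k}}}(p, q).$$
   Context: Let $d\ge 1$, let $n_1,\dots,n_d\ge 2$ and $k_1,\dots,k_d\ge1$ be integers, $\mathbf{k}=(k_1,\dots,k_d)$, and $\alpha>0$. $\mathbb{S}^{n-1}\subset\mathbb{R}^n$ is the unit sphere, $\langle\cdot,\cdot\rangle$ the Euclidean inner product, and $\sphericalangle(\mathbf{u},\mathbf{v})=\arccos\langle\mathbf{u},\mathbf{v}\rangle\in[0,\pi]$ for unit vectors. The $\alpha$-warped pre-Segre--Veronese manifold $\mathcal{P}_\alpha^{\mathbf{k}}$ is $\mathbb{R}_{>0}\times\mathbb{S}^{n_1-1}\times\cdots\times\mathbb{S}^{n_d-1}$ with the Riemannian metric $$g_{(\lambda,\mathbf{u}_1,\ldots,\mathbf{u}_d)}\bigl((\dot{x}, \dot{\mathbf{u}}_1, \ldots, \dot{\mathbf{u}}_d),(\dot{y}, \dot{\mathbf{v}}_1, \ldots, \dot{\mathbf{v}}_d)\bigr)=\dot{x} \dot{y}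 + (\alpha\lambda)^2 \sum_{i=1}^d k_i \langle \dot{\mathbf{u}}_i, \dot{\mathbf{v}}_i \rangle .$$ The $\alpha$-warped Segre--Veronese manifold $\mathcal{S}_\alpha^{\mathbf{k}}$ is the submanifold $\{\lambda\mathbf{u}_1^{\otimes k_1}\otimes\cdots\otimes\mathbf{u}_d^{\otimes k_d}\mid\lambda>0,\ \mathbf{u}_i\in\mathbb{S}^{n_i-1}\}$ of $\mathbb{R}^{n_1^{k_1}\times\cdots\times n_d^{k_d}}\setminus\{0\}$, with the metric induced from the ambient metric $\varsigma^\alpha_{\lambda \mathcal{W}}(\dot{x}\,\mathcal{W}+\lambda\dot{\mathcal{V}},\dot{y}\,\mathcal{W}+\lambda\dot{\mathcal{V}}')=\dot{x}\dot{y}+(\alpha\lambda)^2\langle\dot{\mathcal{V}},\dot{\mathcal{V}}'\rangle$, where $\lambda>0$, $\|\mathcal{W}\|=1$, $\dot{\mathcal{V}},\dot{\mathcal{V}}'\perp\mathcal{W}$. The map $\otimes:\mathcal{P}_\alpha^{\mathbf{k}}\to\mathcal{S}_\alpha^{\mathbf{k}}$ is $(\lambda,\mathbf{u}_1,\dots,\mathbf{u}_d)\mapsto\lambda\mathbf{u}_1^{\otimes k_1}\otimes\cdots\otimes\mathbf{u}_d^{\otimes k_d}$; elements of $\otimes^{-1}(\mathcal{P})$ are representatives of $\mathcal{P}$. $\operatorname{dist}_{\mathcal{M}}$ is the intrinsic distance (infimum of lengths of piecewise smooth curves in $\mathcal{M}$). For $p=(\lambda,\mathbf{u}_1,\dots,\mathbf{u}_d)$,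 $q=(\mu,\mathbf{v}_1,\dots,\mathbf{v}_d)$ in $\mathcal{P}_\alpha^{\mathbf{k}}$ put $M(p,q)=\sqrt{\sum_{i=1}^d k_i\,\sphericalangle^2(\mathbf{u}_i,\mathbf{v}_i)}$. They are $\alpha$-compatible if $M(p,q)<\pi/\alpha$. Representatives $p^\star\in\otimes^{-1}(\mathcal{P})$, $q^\star\in\otimes^{-1}(\mathcal{Q})$ are matched if $(p^\star,q^\star)$ minimizes $M(p,q)$ over $p\in\otimes^{-1}(\mathcal{P})$, $q\in\otimes^{-1}(\mathcal{Q})$. For $\alpha$-compatible $p,q$, one has $\operatorname{dist}_{\mathcal{P}_\alpha^{\mathbf{k}}}(p,q)=\sqrt{\lambda^2-2\lambda\mu\cos(\alpha M(p,q))+\mu^2}$. *)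

(* Defs.v *)
From HB Require Import structures.
From mathcomp Require Import all_boot all_order all_algebra.
From mathcomp Require Import all_classical all_reals all_analysis.


Import Order.TTheory GRing.Theory Num.Theory.
Import numFieldNormedType.Exports.

Local Open Scope classical_set_scope.
Local Open Scope ring_scope.

(* For a finite type I, the Euclidean space R^I is the type I -> R. *)

Definition inner {R : realType} {I : finType} (x y : I -> R) : R :=
  \sum_i x i * y i.

Definition enorm {R : realType} {I : finType} (x : I -> R) : R :=
  Num.sqrt (inner x x).

Definition usphere {R : realType} {I : finType} : set (I -> R) :=
  [set x | enorm x = 1].

Definition angle {R : realType} {I : finType} (u v : I -> R) : R :=
  acos (inner u v).

(* C^infinity on the whole real line *)
Definition smooth {R : realType} (f : R -> R) : Prop :=
  forall (m : nat) (t : R), derivable (derive1n m f) t 1.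

Definition velocity {R : realType} {I : finType} (c : R -> I -> R) (t : R) :
    I -> R :=
  fun i => derive1 (fun s => c s i) t.

(* There is a subdivision 0 = t_0 < t_1 < ... < t_m = 1 such that on every
   closed piece [t_j, t_(j+1)] the curve has a smooth extension; consecutive
   pieces share an endpoint, so such a curve is continuous on [0, 1].  Here s is
   the list t_1, ..., t_m.  A curve with values in an embedded submanifold of R^I
   is piecewise smooth for the submanifold iff it is for R^I. *)
Definition piecewise_smooth {R : realType} {I : finType} (c : R -> I -> R) :
    Prop :=
  exists s : seq R, itv_partition 0 1 s /\
    forall (j : nat), (j < size s)%N -> forall i : I,
      exists2 h : R -> R, smooth h &
        forall t : R, t \in `[nth 0 (0 :: s) j, nth 0 (0 :: s) j.+1] ->
          c t i = h t.

(* The velocity is meaningless at the finitely many break points and at 0 and 1;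
   these form a null set. *)
Definition curve_length {R : realType} {I : finType}
    (g : (I -> R) -> (I -> R) -> (I -> R) -> R) (c : R -> I -> R) : \bar R :=
  (\int[lebesgue_measure]_(t in `[0%R, 1%R])
     (Num.sqrt (g (c t) (velocity c t) (velocity c t)))%:E)%E.

Definition curves {R : realType} {I : finType} (M : set (I -> R))
    (p q : I -> R) : set (R -> I -> R) :=
  [set c | [/\ piecewise_smooth c, forall t : R, t \in `[0, 1] -> M (c t),
             c 0 = p & c 1 = q]].

(* Intrinsic distance of a submanifold M of R^I with the Riemannian metric
   g x : T_x M -> T_x M -> R, given by a formula on all of R^I. *)
Definition intrinsic_dist {R : realType} {I : finType} (M : set (I -> R))
    (g : (I -> R) -> (I -> R) -> (I -> R) -> R) (p q : I -> R) : \bar R :=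
  ereal_inf [set curve_length g c | c in curves M p q].

(* R^(pre_index n) is R * R^(n_1) * ... * R^(n_d). *)
Definition pre_index {d : nat} (n : 'I_d -> nat) : finType :=
  (unit + {i : 'I_d & 'I_(n i)})%type.

Definition scal {R : realType} {d : nat} {n : 'I_d -> nat}
    (p : pre_index n -> R) : R :=
  p (inl tt).

Definition direction {R : realType} {d : nat} {n : 'I_d -> nat}
    (p : pre_index n -> R) (i : 'I_d) : 'I_(n i) -> R :=
  fun j => p (inr (Tagged (fun i => 'I_(n i)) j)).

Definition pre_SV (R : realType) {d : nat} (n : 'I_d -> nat) :
    set (pre_index n -> R) :=
  [set p | 0 < scal p /\ forall i, usphere (direction p i)].

Definition pre_metric {R : realType} {d : nat} {n : 'I_d -> nat}
    (k : 'I_d -> nat) (alpha : R) (p x y : pre_index n -> R) : R :=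
  scal x * scal y +
  (alpha * scal p) ^+ 2 *
    \sum_(i < d) (k i)%:R * inner (direction x i) (direction y i).

Definition dist_pre_SV {R : realType} {d : nat} {n : 'I_d -> nat}
    (k : 'I_d -> nat) (alpha : R) (p q : pre_index n -> R) : \bar R :=
  intrinsic_dist (pre_SV R n) (pre_metric k alpha) p q.

(* R^(tensor_index n k) is the space of tensors with k_i modes of dimension n_i
   for every i. *)
Definition tensor_index {d : nat} (n k : 'I_d -> nat) : finType :=
  {dffun forall i : 'I_d, {ffun 'I_(k i) -> 'I_(n i)}}.

(* lambda u_1^{(x) k_1} (x) ... (x) u_d^{(x) k_d} *)
Definition segre {R : realType} {d : nat} {n : 'I_d -> nat} (k : 'I_d -> nat)
    (p : pre_index n -> R) : tensor_index n k -> R :=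
  fun J => scal p * \prod_(i < d) \prod_(j < k i) direction p i (J i j).

Definition SV (R : realType) {d : nat} (n k : 'I_d -> nat) :
    set (tensor_index n k -> R) :=
  [set segre k p | p in pre_SV R n].

(* At the nonzero point X = l W with l > 0 and |W| = 1, a tangent vector Z is
   uniquely Z = z W + l V with V orthogonal to W. *)
Definition radial_part {R : realType} {I : finType} (X Z : I -> R) : R :=
  inner Z (fun i => X i / enorm X).

Definition angular_part {R : realType} {I : finType} (X Z : I -> R) : I -> R :=
  fun i => (Z i - radial_part X Z * (X i / enorm X)) / enorm X.

Definition warped_metric {R : realType} {I : finType} (alpha : R)
    (X Y Z : I -> R) : R :=
  radial_part X Y * radial_part X Z +
  (alpha * enorm X) ^+ 2 * inner (angular_part X Y) (angular_part X Z).

Definition dist_SV {R : realType} {d : nat} {n k : 'I_d -> nat} (alpha : R)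
    (P Q : tensor_index n k -> R) : \bar R :=
  intrinsic_dist (SV R n k) (warped_metric alpha) P Q.

Definition representatives {R : realType} {d : nat} {n k : 'I_d -> nat}
    (P : tensor_index n k -> R) : set (pre_index n -> R) :=
  [set p | pre_SV R n p /\ segre k p = P].

Definition Mdist {R : realType} {d : nat} {n : 'I_d -> nat} (k : 'I_d -> nat)
    (p q : pre_index n -> R) : R :=
  Num.sqrt (\sum_(i < d) (k i)%:R * angle (direction p i) (direction q i) ^+ 2).

Definition compatible {R : realType} {d : nat} {n : 'I_d -> nat}
    (k : 'I_d -> nat) (alpha : R) (p q : pre_index n -> R) : Prop :=
  Mdist k p q < pi / alpha.

Definition matched {R : realType} {d : nat} {n k : 'I_d -> nat}
    (P Q : tensor_index n k -> R) (p q : pre_index n -> R) : Prop :=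
  [/\ representatives P p, representatives Q q &
      forall p' q', representatives P p' -> representatives Q q' ->
        Mdist k p q <= Mdist k p' q'].

(* Main.v *)
Require Import Defs.
From HB Require Import structures.
From mathcomp Require Import all_boot all_order all_algebra.
From mathcomp Require Import all_classical all_reals all_analysis.
From mathcomp Require Import measurable_realfun ring lra.

Set Implicit Arguments.
Unset Strict Implicit.
Unset Printing Implicit Defensive.

Import Order.TTheory GRing.Theory Num.Theory.
Import numFieldNormedType.Exports.

Local Open Scope classical_set_scope.
Local Open Scope ring_scope.

(** Both distances are equal to the planar distance D between the points with
    polar coordinates (la, 0) and (mu, alpha M), where la and mu are the
    radii of p and q, and M = Mdist k p q; this is cone_dist below. Three
    inequalities close a circle.

    dist_SV <= dist_pre_SV holds because segre is an isometric immersion, so it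
    maps curves to curves of the same length (dist_SV_le_dist_pre_SV): by
    the Leibniz rule the derivative of a tensor power is a sum of product
    tensors, which are pairwise orthogonal since u_i' is orthogonal to u_i.

    dist_pre_SV <= D is shown by a geodesic (dist_pre_SV_le_cone_dist): the
    directions run along great circles in such a way that the radius and alpha
    times the angular arc length are the polar coordinates of a planar segment.
    The segment does not meet the origin because alpha M < pi.

    D <= dist_SV is the main point (cone_dist_le_dist_SV). A curve h in the
    Segre--Veronese manifold need not be lifted. Write h = r W with W a unit
    tensor, and let L be the Euclidean length of W.
    - L is at least M. Tensors of norm one have inner product
      prod_i (cos a_i)^(k_i), where the a_i are the angles between the
      directions, so a short chord between two of them is almost as long as
      Mdist between representatives with suitable signs (near_representative).
      Adding up over a fine subdivision gives a representative q' of the end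
      point with Mdist k p q' <= (1 + eps) L (arc_representative), and matched
      representatives satisfy Mdist k p q <= Mdist k p q'.
    - Hence the angle m * (arc length of W) with a suitable constant m <= alpha
      increases by exactly alpha M in total. With the radius r it describes a
      plane curve that is at most as long as h (plane_increment_le), and its end
      points have distance D.
    Both estimates are proved on the pieces where h is smooth (curve_piece) and
    then added (curve_total). *)

(** * Euclidean spaces, angles and great circles *)

Section Euclidean.
Context {R : realType} {I : finType}.
Implicit Types x y z : I -> R.

Lemma innerC x y : inner x y = inner y x.
Proof. by apply: eq_bigr => i _; rewrite mulrC. Qed.

Lemma inner_lincombl a b x y z :
  inner (fun i => a * x i + b * y i) z = a * inner x z + b * inner y z.
Proof.
rewrite /inner !mulr_sumr -big_split; apply: eq_bigr => i _ /=.
by rewrite mulrDl !mulrA.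
Qed.

Lemma inner_lincombr a b x y z :
  inner z (fun i => a * x i + b * y i) = a * inner z x + b * inner z y.
Proof. by rewrite innerC inner_lincombl !(innerC z). Qed.

Lemma inner_scalel a x z : inner (fun i => a * x i) z = a * inner x z.
Proof. by rewrite /inner mulr_sumr; apply: eq_bigr => i _; rewrite mulrA. Qed.

Lemma inner_scaler a x z : inner z (fun i => a * x i) = a * inner z x.
Proof. by rewrite innerC inner_scalel innerC. Qed.

Lemma inner_ge0 x : 0 <= inner x x.
Proof. by apply: sumr_ge0 => i _; rewrite -expr2 sqr_ge0. Qed.

Lemma inner_eq0 x : inner x x = 0 -> x = (fun=> 0).
Proof.
move=> /eqP; rewrite psumr_eq0 => [/allP x0|i _]; last by rewrite -expr2 sqr_ge0.
by apply/funext => i; apply/eqP; have := x0 i (mem_index_enum i);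
  rewrite mulf_eq0 orbb.
Qed.

Lemma enorm_ge0 x : 0 <= enorm x.
Proof. exact: sqrtr_ge0. Qed.

Lemma enorm_sqr x : enorm x ^+ 2 = inner x x.
Proof. by rewrite sqr_sqrtr ?inner_ge0. Qed.

Lemma enorm_scale a x : 0 <= a -> enorm (fun i => a * x i) = a * enorm x.
Proof.
move=> a0; rewrite /enorm inner_scalel inner_scaler mulrA -expr2.
by rewrite sqrtrM ?sqr_ge0// sqrtr_sqr ger0_norm.
Qed.

Lemma usphereE x : usphere x <-> inner x x = 1.
Proof.
rewrite /usphere/= /enorm; split=> [h|->]; last by rewrite sqrtr1.
by rewrite -[LHS]sqr_sqrtr ?inner_ge0// h expr1n.
Qed.

Lemma usphere_normalize x : 0 < enorm x ->
  usphere (fun i => x i / enorm x).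
Proof.
move=> x0; rewrite /usphere/=.
rewrite (_ : (fun i => _) = (fun i => (enorm x)^-1 * x i)).
  by rewrite enorm_scale ?invr_ge0 ?ltW// mulVf ?gt_eqF.
by apply/funext => i; rewrite mulrC.
Qed.

Lemma cauchy_schwarz x y : inner x y <= enorm x * enorm y.
Proof.
have [/eqP xy0|xy0] := boolP (inner y y == 0).
  rewrite {1}(inner_eq0 xy0) /inner big1 ?mulr_ge0 ?enorm_ge0// => i _.
  by rewrite mulr0.
have y0 : 0 < inner y y by rewrite lt_neqAle eq_sym xy0 inner_ge0.
rewrite -[_ * _]ger0_norm ?mulr_ge0 ?enorm_ge0//.
apply: le_trans (ler_norm _) _.
rewrite -ler_sqr ?nnegrE// !real_normK ?num_real// exprMn !enorm_sqr.
have := inner_ge0 (fun i => inner y y * x i + (- inner x y) * y i).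
rewrite inner_lincombl !inner_lincombr (innerC y x).
rewrite [leRHS](_ : _ = inner y y * (inner x x * inner y y - inner x y ^+ 2)).
  by rewrite pmulr_rge0// subr_ge0.
by ring.
Qed.

Lemma enorm_triangle x y : enorm (fun i => x i + y i) <= enorm x + enorm y.
Proof.
rewrite -ler_sqr ?nnegrE ?addr_ge0 ?enorm_ge0// sqrrD !enorm_sqr.
have -> : (fun i => x i + y i) = (fun i => 1 * x i + 1 * y i).
  by apply/funext => i; rewrite !mul1r.
rewrite inner_lincombl !inner_lincombr !mul1r (innerC y x).
by have := cauchy_schwarz x y; lra.
Qed.

Lemma enorm_le x y : (forall i, 0 <= x i <= y i) -> enorm x <= enorm y.
Proof.
move=> xy; rewrite ler_sqrt ?inner_ge0//; apply: ler_sum => i _.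
by have /andP[x0 xyi] := xy i; apply: ler_pM.
Qed.

Lemma inner_usphere x y : usphere x -> usphere y -> -1 <= inner x y <= 1.
Proof.
move=> x1 y1; apply/andP; split; last first.
  by have := cauchy_schwarz x y; rewrite x1 y1 mulr1.
have := cauchy_schwarz (fun i => -1 * x i) y.
rewrite inner_scalel mulN1r y1 mulr1 /enorm inner_scalel inner_scaler !mulN1r.
by rewrite opprK -/(enorm x) x1 lerNl.
Qed.

Lemma cos_angle x y : usphere x -> usphere y -> cos (angle x y) = inner x y.
Proof. by move=> x1 y1; rewrite acosK// in_itv/= inner_usphere. Qed.

Lemma angle_ge0 x y : usphere x -> usphere y -> 0 <= angle x y.
Proof. by move=> x1 y1; rewrite acos_ge0 ?inner_usphere. Qed.

Lemma angle_lepi x y : usphere x -> usphere y -> angle x y <= pi.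
Proof. by move=> x1 y1; rewrite acos_lepi ?inner_usphere. Qed.

Lemma sin_angle x y : usphere x -> usphere y ->
  sin (angle x y) = Num.sqrt (1 - inner x y ^+ 2).
Proof. by move=> x1 y1; rewrite sin_acos ?inner_usphere. Qed.

(** The components of x and z orthogonal to y have norms sin (angle x y) and
    sin (angle y z); Cauchy--Schwarz applied to them says that
    cos (angle x z) is at least the cosine of the sum of the angles. *)
Lemma angle_triangle x y z : usphere x -> usphere y -> usphere z ->
  angle x z <= angle x y + angle y z.
Proof.
move=> x1 y1 z1.
have [sumpi|/ltW sumpi] := leP pi (angle x y + angle y z).
  exact: le_trans (angle_lepi x1 z1) sumpi.
have sum0 : 0 <= angle x y + angle y z by rewrite addr_ge0 ?angle_ge0.
rewrite leNgt; apply/negP => lt_xz.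
have xzI : angle x z \in `[0, pi] by rewrite in_itv/= angle_ge0 ?angle_lepi.
have sumI : angle x y + angle y z \in `[0, pi] by rewrite in_itv/= sum0.
have : cos (angle x z) < cos (angle x y + angle y z) by rewrite ltr_cos.
rewrite cosD !cos_angle// !sin_angle// ltNge => /negP; apply.
have := cauchy_schwarz (fun i => (-1) * x i + inner x y * y i)
                       (fun i => 1 * z i + (- inner y z) * y i).
have /usphereE xx := x1; have /usphereE yy := y1; have /usphereE zz := z1.
rewrite {1}inner_lincombl !inner_lincombr /enorm.
rewrite !inner_lincombl !inner_lincombr xx yy zz (innerC y x) (innerC z y).
rewrite (_ : -1 * (-1 * 1 + inner x y * inner x y) + _ = 1 - inner x y ^+ 2);
  last by ring.
rewrite (_ : 1 * (1 * 1 + - inner y z * inner y z) + _ = 1 - inner y z ^+ 2);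
  last by ring.
lra.
Qed.

End Euclidean.

Section GreatCircles.
Context {R : realType} {I : finType}.
Implicit Types u v w : I -> R.

Lemma exists_orthogonal u (j j' : I) : j != j' -> usphere u ->
  exists2 w, usphere w & inner u w = 0.
Proof.
move=> jj' /usphereE uu.
pose e (l i : I) : R := (i == l)%:R.
have eE l x : inner (e l) x = x l.
  rewrite /inner (bigD1 l)//= /e eqxx mul1r big1 ?addr0// => i /negbTE ->.
  by rewrite mul0r.
have [l l1] : exists l, u l ^+ 2 != 1.
  have [j1|] := eqVneq (u j ^+ 2) 1; last by exists j.
  have [j'1|] := eqVneq (u j' ^+ 2) 1; last by exists j'.
  have : 0 <= \sum_(i | (i != j) && (i != j')) u i * u i.
    by apply: sumr_ge0 => i _; rewrite -expr2 sqr_ge0.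
  move: uu; rewrite /inner (bigD1 j)//= (bigD1 j')/= 1?eq_sym// -!expr2 j1 j'1.
  by lra.
pose w0 i := 1 * e l i + (- u l) * u i.
have w0w0 : inner w0 w0 = 1 - u l ^+ 2.
  rewrite /w0 inner_lincombl !inner_lincombr !eE uu (innerC u) eE /e eqxx.
  by rewrite /=; ring.
have w00 : 0 < enorm w0.
  rewrite lt_neqAle enorm_ge0 andbT eq_sym; apply/eqP => w00.
  have := enorm_sqr w0; rewrite w00 w0w0 expr0n/= => /esym/eqP.
  by rewrite subr_eq0 eq_sym (negbTE l1).
exists (fun i => w0 i / enorm w0); first exact: usphere_normalize.
rewrite (_ : (fun i => _) = (fun i => (enorm w0)^-1 * w0 i)); last first.
  by apply/funext => i; rewrite mulrC.
rewrite inner_scaler /w0 inner_lincombr (innerC u) eE uu.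
by ring.
Qed.

(** For antipodal u and v the great circle through u and v is not unique: this
    is where the sphere must have positive dimension. *)
Lemma great_circle u v (j j' : I) : j != j' -> usphere u -> usphere v ->
  exists w, [/\ usphere w, inner u w = 0 &
    v = (fun i => cos (angle u v) * u i + sin (angle u v) * w i)].
Proof.
move=> jj' u1 v1; have /usphereE uu := u1; have /usphereE vv := v1.
set a := angle u v.
have ca : cos a = inner u v by exact: cos_angle.
have cs : cos a ^+ 2 + sin a ^+ 2 = 1 := cos2Dsin2 a.
pose z i := 1 * v i + (- cos a) * u i.
have zz : inner z z = sin a ^+ 2.
  rewrite /z inner_lincombl !inner_lincombr uu vv (innerC v u) -ca.
  by rewrite (_ : sin a ^+ 2 = 1 - cos a ^+ 2); [ring|rewrite -cs; ring].
have uz : inner u z = 0 by rewrite /z inner_lincombr uu -ca; ring.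
have [s0|s0] := eqVneq (sin a) 0.
  have [w w1 uw] := exists_orthogonal jj' u1; exists w; split=> //.
  have z0 : z = (fun=> 0) by apply: inner_eq0; rewrite zz s0 expr0n.
  apply/funext => i; have := congr1 (fun f => f i) z0.
  by rewrite /z s0; lra.
exists (fun i => (sin a)^-1 * z i); split.
- by apply/usphereE; rewrite inner_scalel inner_scaler zz; field.
- by rewrite inner_scaler uz mulr0.
- by apply/funext => i; rewrite /z; field.
Qed.

End GreatCircles.

(** * Product tensors and the warped metric *)

Section ProductTensors.
Context {R : realType} {d : nat}.

Lemma sum_dffun_prod (T : 'I_d -> finType) (F : forall i, T i -> R) :
  \sum_(J : {dffun forall i, T i}) \prod_i F i (J i) =
  \prod_i \sum_(x : T i) F i x.
Proof.
transitivity (\sum_(t : fprod T) \prod_(i in 'I_d) F i (t i)).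
  rewrite (reindex (@dffun_of_fprod _ T)); last first.
    exact/onW_bij/dffun_of_fprod_bij.
  by apply: eq_bigr => t _; apply: eq_bigr => i _; rewrite ffunE.
pose P i : {ffun T i -> R} := [ffun x => F i x].
transitivity (\sum_(t : fprod T) \prod_(i in 'I_d) P i (t i)).
  by apply: eq_bigr => t _; apply: eq_bigr => i _; rewrite ffunE.
rewrite big_fprod.
apply: etrans (esym (bigA_distr_big_dep (fun i => tagged_with T i)
  (fun i => untag 0 (P i)))) _.
apply: eq_bigr => i _.
transitivity (\sum_(x : T i) P i x); last by apply: eq_bigr => x _; rewrite ffunE.
by rewrite (big_tag (fun i x => P i x)).
Qed.

Context {n k : 'I_d -> nat}.

(** A tensor factor: the vector u_i is used in k_i slots. *)
Definition slot : finType := {i : 'I_d & 'I_(k i)}.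

Lemma prod_slot (F : forall i, 'I_(k i) -> R) :
  \prod_i \prod_(j < k i) F i j = \prod_(s : slot) F (tag s) (tagged s).
Proof. by rewrite (sig_big_dep _ (fun _ => xpredT) F). Qed.

Lemma prod_slot_cst (F : 'I_d -> R) :
  \prod_(s : slot) F (tag s) = \prod_i F i ^+ k i.
Proof.
rewrite -(prod_slot (fun i _ => F i)); apply: eq_bigr => i _.
by rewrite prodr_const card_ord.
Qed.

Lemma sum_slot_cst (F : 'I_d -> R) :
  \sum_(s : slot) F (tag s) = \sum_i (k i)%:R * F i.
Proof.
transitivity (\sum_i \sum_(j < k i) F i).
  by rewrite (sig_big_dep _ (fun _ => xpredT) (fun i _ => F i)).
by apply: eq_bigr => i _; rewrite sumr_const card_ord mulr_natl.
Qed.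

Definition ptensor (a : forall s : slot, 'I_(n (tag s)) -> R) :
    tensor_index n k -> R :=
  fun J => \prod_(s : slot) a s (J (tag s) (tagged s)).

Lemma inner_ptensor a b :
  inner (ptensor a) (ptensor b) = \prod_(s : slot) inner (a s) (b s).
Proof.
pose a' i (j : 'I_(k i)) : 'I_(n i) -> R := a (Tagged (fun i => 'I_(k i)) j).
pose b' i (j : 'I_(k i)) : 'I_(n i) -> R := b (Tagged (fun i => 'I_(k i)) j).
transitivity (\prod_i \prod_(j < k i) inner (a' i j) (b' i j)); last first.
  by rewrite prod_slot; apply: eq_bigr => -[i j].
pose F i (f : {ffun 'I_(k i) -> 'I_(n i)}) :=
  \prod_(j < k i) (a' i j (f j) * b' i j (f j)).
transitivity (\sum_(J : tensor_index n k) \prod_i F i (J i)).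
  apply: eq_bigr => J _; rewrite /ptensor -big_split /= /F.
  by rewrite (prod_slot (fun i j => a' i j (J i j) * b' i j (J i j)));
    apply: eq_bigr => -[i j].
rewrite sum_dffun_prod; apply: eq_bigr => i _.
by rewrite /F /inner bigA_distr_bigA.
Qed.

Implicit Types u x : forall i, 'I_(n i) -> R.

(** u_1^{(x) k_1} (x) ... (x) u_d^{(x) k_d} *)
Definition utensor u : tensor_index n k -> R :=
  ptensor (fun s => u (tag s)).

Lemma segreE (p : pre_index n -> R) :
  segre k p = fun J => scal p * utensor (direction p) J.
Proof.
apply/funext => J; rewrite /segre /utensor /ptensor.
by rewrite (prod_slot (fun i j => direction p i (J i j))).
Qed.

Lemma inner_utensor u v :
  inner (utensor u) (utensor v) = \prod_i inner (u i) (v i) ^+ k i.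
Proof. by rewrite inner_ptensor (prod_slot_cst (fun i => inner (u i) (v i))). Qed.

Definition subst_slot u x (s t : slot) : 'I_(n (tag t)) -> R :=
  if t == s then x (tag t) else u (tag t).

(** The derivative of utensor at u in the direction x, by the Leibniz rule. *)
Definition dutensor u x : tensor_index n k -> R :=
  fun J => \sum_(s : slot) ptensor (subst_slot u x s) J.

Lemma inner_sum_ptensorr (z : tensor_index n k -> R) u x :
  inner z (dutensor u x) = \sum_(s : slot) inner z (ptensor (subst_slot u x s)).
Proof.
rewrite /inner exchange_big /=; apply: eq_bigr => J _.
by rewrite mulr_sumr.
Qed.

Lemma inner_utensor_dutensor u x : (forall i, inner (u i) (x i) = 0) ->
  inner (utensor u) (dutensor u x) = 0.
Proof.
move=> ux; rewrite inner_sum_ptensorr big1// => s _.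
rewrite inner_ptensor (bigD1 s)//=.
by rewrite /subst_slot eqxx ux mul0r.
Qed.

(** Distinct summands of the Leibniz rule are orthogonal: in the slot where
    one of them has x, the other has u. *)
Lemma inner_dutensor u x :
  (forall i, usphere (u i)) -> (forall i, inner (u i) (x i) = 0) ->
  inner (dutensor u x) (dutensor u x) = \sum_i (k i)%:R * inner (x i) (x i).
Proof.
move=> u1 ux; rewrite inner_sum_ptensorr.
rewrite -(sum_slot_cst (fun i => inner (x i) (x i))).
apply: eq_bigr => s _; rewrite innerC inner_sum_ptensorr (bigD1 s)//= big1.
  rewrite addr0 inner_ptensor (bigD1 s)//= {1 2}/subst_slot eqxx.
  rewrite big1 ?mulr1// => t /negbTE ts.
  by rewrite /subst_slot ts; apply/usphereE.
move=> t ts; rewrite inner_ptensor (bigD1 s)//=.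
by rewrite /subst_slot eqxx eq_sym (negbTE ts) innerC ux mul0r.
Qed.

Lemma usphere_utensor u : (forall i, usphere (u i)) -> usphere (utensor u).
Proof.
move=> u1; apply/usphereE; rewrite inner_utensor big1// => i _.
by have /usphereE -> := u1 i; rewrite expr1n.
Qed.

End ProductTensors.

Section WarpedMetric.
Context {R : realType} {I : finType}.
Implicit Types W V Z : I -> R.

(** The coordinates X = l W and Z = z W + l V in which the warped metric is
    defined. *)
Lemma warped_metric_polar (alpha l z : R) W V : 0 < l -> usphere W ->
  inner W V = 0 ->
  warped_metric alpha (fun i => l * W i) (fun i => z * W i + l * V i)
    (fun i => z * W i + l * V i) = z ^+ 2 + (alpha * l) ^+ 2 * inner V V.
Proof.
move=> l0 W1 WV; have /usphereE WW := W1.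
have lE : enorm (fun i => l * W i) = l by rewrite enorm_scale ?ltW// W1 mulr1.
have XE : (fun i => l * W i / enorm (fun i => l * W i)) = W.
  by apply/funext => i; rewrite lE mulrAC mulfV ?gt_eqF// mul1r.
have rE : radial_part (fun i => l * W i) (fun i => z * W i + l * V i) = z.
  by rewrite /radial_part XE inner_lincombl WW (innerC V) WV; ring.
have aE : angular_part (fun i => l * W i) (fun i => z * W i + l * V i) = V.
  apply/funext => i; rewrite /angular_part rE.
  by have /(congr1 (fun f => f i)) /= -> := XE; rewrite lE; field; rewrite gt_eqF.
by rewrite /warped_metric rE aE lE expr2.
Qed.

End WarpedMetric.

(** * Derivatives of curves *)

Section ScalarDerivatives.
Context {R : realType}.
Implicit Types (f g : R -> R) (t a b : R).

Lemma is_derive_add f g t a b : is_derive t 1 f a -> is_derive t 1 g b ->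
  is_derive t 1 (fun s => f s + g s) (a + b).
Proof. by move=> df dg; exact: is_deriveD. Qed.

Lemma is_derive_mul f g t a b : is_derive t 1 f a -> is_derive t 1 g b ->
  is_derive t 1 (fun s => f s * g s) (a * g t + f t * b).
Proof.
move=> df dg; apply: is_derive_eq (is_deriveM _ _) _.
by rewrite addrC mulrC /GRing.scale/=.
Qed.

Lemma is_derive_bigsum (I : Type) (r : seq I) (F : I -> R -> R) (F' : I -> R) t :
  (forall i, is_derive t 1 (F i) (F' i)) ->
  is_derive t 1 (fun s => \sum_(i <- r) F i s) (\sum_(i <- r) F' i).
Proof.
move=> dF; elim: r => [|i r IH].
  rewrite big_nil (_ : (fun _ => _) = cst 0); first exact: is_derive_cst.
  by apply/funext => s; rewrite big_nil.
rewrite big_cons.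
rewrite (_ : (fun _ => _) = (fun s => F i s + \sum_(j <- r) F j s)).
  exact: is_derive_add.
by apply/funext => s; rewrite big_cons.
Qed.

Lemma is_derive_bigprod (I : finType) (F : I -> R -> R) (F' : I -> R) t :
  (forall i, is_derive t 1 (F i) (F' i)) ->
  is_derive t 1 (fun s => \prod_i F i s)
    (\sum_i \prod_j (if j == i then F' j else F j t)).
Proof.
move=> dF; have := index_enum_uniq I; elim: (index_enum I) => [_|i r IH].
  rewrite big_nil (_ : (fun _ => _) = cst 1); first exact: is_derive_cst.
  by apply/funext => s; rewrite big_nil.
move=> /= /andP[ir /IH dr].
rewrite (_ : (fun _ => _) = (fun s => F i s * \prod_(j <- r) F j s)); last first.
  by apply/funext => s; rewrite big_cons.
apply: is_derive_eq (is_derive_mul (dF i) dr) _.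
rewrite big_cons !big_cons eqxx; congr (_ * _ + _).
  apply: eq_big_seq => j jr; case: eqP => // ji.
  by rewrite -ji jr in ir.
rewrite mulr_sumr; apply: eq_big_seq => j jr; rewrite big_cons.
by case: eqP => // ij; rewrite -ij (negbTE ir) in jr *.
Qed.

Lemma derive1_is_derive f t a : is_derive t 1 f a -> derive1 f t = a.
Proof. by move=> df; rewrite derive1E derive_val. Qed.

Lemma is_derive_near_cst f t a c : is_derive t 1 f a ->
  (\near t, f t = c) -> a = 0.
Proof.
move=> df fc; have : is_derive t 1 f 0.
  by apply: near_eq_is_derive (is_derive_cst c t 1); near do apply/esym.
by move=> df0; rewrite -(derive1_is_derive df) (derive1_is_derive df0).
Unshelve. all: by end_near. Qed.

Lemma near_eq_derive1 f g t a : is_derive t 1 g a ->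
  (\near t, f t = g t) -> derive1 f t = a.
Proof.
move=> dg fg; apply: derive1_is_derive; apply: near_eq_is_derive dg.
by near do apply/esym.
Unshelve. all: by end_near. Qed.

Lemma is_derive_continuous f t a : is_derive t 1 f a -> {for t, continuous f}.
Proof.
move=> df; apply/differentiable_continuous/derivable1_diffP.
exact: ex_derive.
Qed.

End ScalarDerivatives.

Definition vderive {R : realType} {I : finType} (c : R -> I -> R) (t : R)
    (v : I -> R) : Prop :=
  forall i, is_derive t 1 (fun s => c s i) (v i).

Section VectorDerivatives.
Context {R : realType} {I : finType}.
Implicit Types (c e : R -> I -> R) (t : R) (v w : I -> R).

Lemma vderive_inner c e t v w : vderive c t v -> vderive e t w ->
  is_derive t 1 (fun s => inner (c s) (e s)) (inner v (e t) + inner (c t) w).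
Proof.
move=> dc de; rewrite /inner -big_split/=.
by apply: is_derive_bigsum => i; exact: is_derive_mul.
Qed.

Lemma vderive_enorm c t v : 0 < enorm (c t) -> vderive c t v ->
  is_derive t 1 (fun s => enorm (c s)) (radial_part (c t) v).
Proof.
move=> c0 dc.
have cc0 : 0 < inner (c t) (c t) by rewrite -enorm_sqr exprn_gt0.
rewrite -[fun s => enorm (c s)]/(Num.sqrt \o (fun s => inner (c s) (c s))).
apply: is_derive_eq
  (is_derive1_comp (is_derive1_sqrt cc0) (vderive_inner dc dc)) _.
rewrite -/(enorm (c t)) /radial_part.
rewrite (_ : (fun i => _) = (fun i => (enorm (c t))^-1 * c t i)); last first.
  by apply/funext => i; rewrite mulrC.
rewrite inner_scaler (innerC (c t)).
by field; rewrite gt_eqF.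
Qed.

Lemma vderive_normalize c t v : 0 < enorm (c t) -> vderive c t v ->
  vderive (fun s i => c s i / enorm (c s)) t (angular_part (c t) v).
Proof.
move=> c0 dc i.
have dinv : is_derive t 1 (fun s => (enorm (c s))^-1)
    (- (enorm (c t)) ^- 2 * radial_part (c t) v).
  apply: (@is_deriveV R (fun s => enorm (c s))); first by rewrite gt_eqF.
  exact: vderive_enorm.
apply: is_derive_eq (is_derive_mul (dc i) dinv) _.
by rewrite /angular_part; field; rewrite gt_eqF.
Qed.

Lemma vderive_usphere c t v : vderive c t v -> (\near t, usphere (c t)) ->
  inner (c t) v = 0.
Proof.
move=> dc c1; have := is_derive_near_cst (c := 1) (vderive_inner dc dc).
rewrite (innerC v) => /(_ _)/eqP; rewrite -mulr2n mulrn_eq0/= => h.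
by apply/eqP/h; near do apply/usphereE.
Unshelve. all: by end_near. Qed.

Lemma velocity_near c e t v : vderive e t v ->
  (\near t, c t = e t) -> velocity c t = v.
Proof.
move=> de ce; apply/funext => i; apply: near_eq_derive1 (de i) _.
by near do apply: (congr1 (fun f => f i)).
Unshelve. all: by end_near. Qed.

End VectorDerivatives.

Section SegreDerivative.
Context {R : realType} {d : nat} {n k : 'I_d -> nat}.

Lemma vderive_segre (c : R -> pre_index n -> R) t v : vderive c t v ->
  vderive (fun s => segre k (c s)) t
    (fun J => scal v * utensor (direction (c t)) J +
      scal (c t) * dutensor (direction (c t)) (direction v) J).
Proof.
move=> dc J; rewrite (_ : (fun s => _) =
    (fun s => scal (c s) * utensor (direction (c s)) J)); last first.
  by apply/funext => s; rewrite segreE.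
apply: is_derive_mul; first exact: dc.
rewrite /utensor /ptensor.
have D := is_derive_bigprod
  (F := fun (s : slot) r => direction (c r) (tag s) (J (tag s) (tagged s)))
  (F' := fun s => direction v (tag s) (J (tag s) (tagged s)))
  (t := t) (fun s => dc _).
apply: is_derive_eq D _; apply: eq_bigr => s _; apply: eq_bigr => r _.
by rewrite /subst_slot; case: eqP.
Qed.

(** The map segre is an isometric immersion for the warped metric. *)
Lemma warped_metric_segre (alpha : R) (p v : pre_index n -> R) : pre_SV R n p ->
  (forall i, inner (direction p i) (direction v i) = 0) ->
  let w := (fun J => scal v * utensor (direction p) J +
              scal p * dutensor (direction p) (direction v) J) in
  warped_metric alpha (segre k p) w w = pre_metric k alpha p v v.
Proof.
move=> [l0 p1] pv /=; rewrite segreE warped_metric_polar//.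
- by rewrite inner_dutensor// /pre_metric expr2.
- exact: usphere_utensor.
- exact: inner_utensor_dutensor.
Qed.

End SegreDerivative.

(** * Smooth functions *)

Section SmoothFunctions.
Context {R : realType}.
Implicit Types (f g : R -> R) (B : set (R -> R)).

Inductive generated B : (R -> R) -> Prop :=
| generated_base f of B f : generated B f
| generated_cst a : generated B (fun=> a)
| generated_add f g of generated B f & generated B g :
    generated B (fun t => f t + g t)
| generated_mul f g of generated B f & generated B g :
    generated B (fun t => f t * g t).

(** If the generators have derivatives in the algebra that they generate, then
    by the Leibniz rule that algebra is stable under differentiation, hence all
    its elements are smooth: no formula for higher derivatives is needed. *)
Lemma generated_smooth B :
  (forall f, B f ->
     exists2 f', generated B f' & forall t : R, is_derive t 1 f (f' t)) ->
  forall f, generated B f -> smooth f.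
Proof.
move=> Bder.
have gen_der f : generated B f ->
    exists2 f', generated B f' & forall t : R, is_derive t 1 f (f' t).
  elim=> [g /Bder//|a|g h gg [g' gg' dg] gh [h' gh' dh]
         |g h gg [g' gg' dg] gh [h' gh' dh]].
  - exists (fun=> 0); first exact: generated_cst.
    by move=> t; exact: is_derive_cst.
  - exists (fun t => g' t + h' t); first exact: generated_add.
    by move=> t; exact: is_derive_add.
  - exists (fun t => g' t * h t + g t * h' t).
      by apply: generated_add; exact: generated_mul.
    by move=> t; exact: is_derive_mul.
have gen_derive1 f : generated B f -> generated B (derive1 f).
  move=> /gen_der[f' gf' df]; rewrite (_ : derive1 f = f')//.
  by apply/funext => t; exact: derive1_is_derive.
move=> f gf m t; have : generated B (derive1n m f).
  by elim: m => [//|m IH]; rewrite derive1nS; exact: gen_derive1.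
by move=> /gen_der[f' _ df]; exact: ex_derive.
Qed.

Lemma smooth_derive1 f : smooth f -> smooth (derive1 f).
Proof. by move=> sf m t; rewrite -derive1Sn; exact: sf. Qed.

Lemma smooth_is_derive f (t : R) : smooth f -> is_derive t 1 f (derive1 f t).
Proof. by move=> /(_ 0%N t) df; rewrite derive1E; exact: derivableP. Qed.

Lemma smooth_generated f : generated smooth f -> smooth f.
Proof.
apply: generated_smooth => {}f sf; exists (derive1 f).
  exact/generated_base/smooth_derive1.
by move=> t; exact: smooth_is_derive.
Qed.

Lemma smooth_mul f g : smooth f -> smooth g -> smooth (fun t => f t * g t).
Proof.
by move=> sf sg; apply: smooth_generated; apply: generated_mul;
  exact: generated_base.
Qed.

Lemma smooth_cst a : smooth (fun=> a : R).
Proof. exact/smooth_generated/generated_cst. Qed.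

Lemma smooth_bigprod (I : Type) (r : seq I) (F : I -> R -> R) :
  (forall i, smooth (F i)) -> smooth (fun t => \prod_(i <- r) F i t).
Proof.
move=> sF; elim: r => [|i r IH].
  rewrite (_ : (fun _ => _) = (fun=> 1)); first exact: smooth_cst.
  by apply/funext => s; rewrite big_nil.
rewrite (_ : (fun _ => _) = (fun s => F i s * \prod_(j <- r) F j s)).
  exact: smooth_mul.
by apply/funext => s; rewrite big_cons.
Qed.

End SmoothFunctions.

Section SmoothExtensions.
Context {R : realType}.
Implicit Types f g tau s : R -> R.

(** This extends generated_smooth to families such as cos (y tau), sin (y tau)
    with tau smooth: their derivatives also involve tau', which is smooth but
    not in the algebra that they generate. *)
Lemma smooth_extend (B : set (R -> R)) :
  (forall f, B f -> exists2 f', generated (smooth `|` B) f' &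
     forall t : R, is_derive t 1 f (f' t)) ->
  forall f, B f -> smooth f.
Proof.
move=> Bder f Bf; apply: (@generated_smooth _ (smooth `|` B)); last first.
  by apply: generated_base; right.
move=> g [sg|/Bder//]; exists (derive1 g); last first.
  by move=> t; exact: smooth_is_derive.
by apply: generated_base; left; exact: smooth_derive1.
Qed.

Lemma smooth_of_derivative f g :
  (forall t : R, is_derive t 1 f (g t)) -> smooth g -> smooth f.
Proof.
move=> df sg; apply: (@smooth_extend [set f]) => // _ ->.
by exists g => //; apply: generated_base; left.
Qed.

Lemma smooth_add f g : smooth f -> smooth g -> smooth (fun t => f t + g t).
Proof.
by move=> sf sg; apply: smooth_generated; apply: generated_add;
  exact: generated_base.
Qed.

Lemma smooth_id : smooth (fun t : R => t).
Proof.
by apply: (@smooth_of_derivative _ (fun=> 1)); exact: smooth_cst.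
Qed.

Lemma is_derive_cos_mul y tau (t tau' : R) : is_derive t 1 tau tau' ->
  is_derive t 1 (fun t => cos (y * tau t)) (- sin (y * tau t) * (y * tau')).
Proof.
move=> dt; have D : is_derive t 1 (fun t => y * tau t) (y * tau').
  apply: is_derive_eq (is_derive_mul (is_derive_cst y t 1) dt) _.
  by rewrite mul0r add0r.
exact: (@is_derive1_comp _ cos (fun t => y * tau t) t _ _ (is_derive_cos _) D).
Qed.

Lemma is_derive_sin_mul y tau (t tau' : R) : is_derive t 1 tau tau' ->
  is_derive t 1 (fun t => sin (y * tau t)) (cos (y * tau t) * (y * tau')).
Proof.
move=> dt; have D : is_derive t 1 (fun t => y * tau t) (y * tau').
  apply: is_derive_eq (is_derive_mul (is_derive_cst y t 1) dt) _.
  by rewrite mul0r add0r.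
exact: (@is_derive1_comp _ sin (fun t => y * tau t) t _ _ (is_derive_sin _) D).
Qed.

Lemma smooth_cos_sin y tau : smooth tau ->
  smooth (fun t => cos (y * tau t)) /\ smooth (fun t => sin (y * tau t)).
Proof.
move=> st.
pose B := [set (fun t => cos (y * tau t)); (fun t => sin (y * tau t))].
have sd : generated (smooth `|` B) (fun t => y * derive1 tau t).
  apply: generated_mul; first exact: generated_cst.
  by apply: generated_base; left; exact: smooth_derive1.
have gc : generated (smooth `|` B) (fun t => cos (y * tau t)).
  by apply: generated_base; right; left.
have gs : generated (smooth `|` B) (fun t => sin (y * tau t)).
  by apply: generated_base; right; right.
have sB : forall f, B f -> smooth f.
  apply: smooth_extend => f [->|->].
  - exists (fun t => ((-1) * sin (y * tau t)) * (y * derive1 tau t)).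
      apply: generated_mul => //.
      by apply: generated_mul => //; exact: generated_cst.
    move=> t; rewrite mulN1r; apply: is_derive_cos_mul.
    exact: smooth_is_derive.
  - exists (fun t => cos (y * tau t) * (y * derive1 tau t)).
      exact: generated_mul.
    by move=> t; apply: is_derive_sin_mul; exact: smooth_is_derive.
by split; apply: sB; [left|right].
Qed.

(** The cosine of the angle atan (s t); its derivative is again polynomial in
    itself, s and s'. *)
Definition cosatan s (t : R) : R := (Num.sqrt (1 + s t ^+ 2))^-1.

Lemma cosatan_gt0 s t : 0 < cosatan s t.
Proof. by rewrite invr_gt0 sqrtr_gt0; have := sqr_ge0 (s t); lra. Qed.

Lemma cosatan_sqr s t : cosatan s t ^+ 2 * (1 + s t ^+ 2) = 1.
Proof.
have h : 0 < 1 + s t ^+ 2 by have := sqr_ge0 (s t); lra.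
by rewrite exprVn sqr_sqrtr ?(ltW h)// mulVf// gt_eqF.
Qed.

Lemma is_derive_cosatan s (t s' : R) : is_derive t 1 s s' ->
  is_derive t 1 (cosatan s) (- (s t * s') * cosatan s t ^+ 3).
Proof.
move=> ds; have h : 0 < 1 + s t ^+ 2 by have := sqr_ge0 (s t); lra.
have dsq : is_derive t 1 (fun t => 1 + s t ^+ 2) (2 * s t * s').
  have := is_derive_add (is_derive_cst (1 : R) t 1) (is_derive_mul ds ds).
  by move=> D; apply: is_derive_eq D _; ring.
have dsqrt : is_derive t 1 (fun t => Num.sqrt (1 + s t ^+ 2)) _ :=
  @is_derive1_comp _ Num.sqrt (fun t => 1 + s t ^+ 2) t _ _
    (is_derive1_sqrt h) dsq.
have sqrt0 : Num.sqrt (1 + s t ^+ 2) != 0 by rewrite gt_eqF// sqrtr_gt0.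
have D : is_derive t 1 (cosatan s) _ :=
  @is_deriveV R (fun t => Num.sqrt (1 + s t ^+ 2)) t _ 1 sqrt0 dsqrt.
apply: is_derive_eq D _.
by rewrite /cosatan /GRing.scale/=; field.
Qed.

Lemma smooth_cosatan s : smooth s -> smooth (cosatan s).
Proof.
move=> ss; apply: (@smooth_extend [set cosatan s]) => // _ ->.
have gc : generated (smooth `|` [set cosatan s]) (cosatan s).
  by apply: generated_base; right.
have gs : generated (smooth `|` [set cosatan s]) s.
  by apply: generated_base; left.
have gs' : generated (smooth `|` [set cosatan s]) (derive1 s).
  by apply: generated_base; left; exact: smooth_derive1.
exists (fun t => ((-1) * (s t * derive1 s t)) *
                 (cosatan s t * (cosatan s t * cosatan s t))).
  apply: generated_mul; last by do 2!apply: generated_mul => //.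
  apply: generated_mul; first exact: generated_cst.
  exact: generated_mul.
move=> t; have ds := smooth_is_derive t ss.
by apply: is_derive_eq (is_derive_cosatan ds) _; ring.
Qed.

End SmoothExtensions.

(** * Integrals over subdivisions, and increments *)

Section IntegralsOnPieces.
Context {R : realType}.
Implicit Types (f g F G : R -> R) (a b : R) (s : seq R).
Notation mu := lebesgue_measure.

(** The speed of a piecewise smooth curve is known only inside the pieces; the
    break points are a null set. *)
Lemma integral_itv_partition f a b s : itv_partition a b s ->
  (forall x, 0 <= f x) ->
  (forall j, (j < size s)%N ->
    measurable_fun `]nth 0 (a :: s) j, nth 0 (a :: s) j.+1[ f) ->
  measurable_fun `[a, b] f /\
  (\int[mu]_(x in `[a, b]) (f x)%:E =
   \sum_(j < size s)
     \int[mu]_(x in `]nth 0%R (a :: s) j, nth 0%R (a :: s) j.+1[) (f x)%:E)%E.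
Proof.
move=> abs f0; elim: s a abs => [|x s IH] a abs mf.
  rewrite (itv_partition_nil abs) set_itv1 integral_set1 big_ord0.
  by split=> //; exact: measurable_fun_set1.
have ax : a < x by case: abs => /= /andP[].
have xb : x <= b := itv_partition_le (itv_partition_cons abs).
have [mxb Ixb] := IH x (itv_partition_cons abs) (fun j => mf j.+1).
have max : measurable_fun `[a, x] f.
  by have /measurable_EFinP/emeasurable_fun_itv_cc/measurable_EFinP := mf 0%N isT.
have mxb' : measurable_fun `]x, b] f.
  by apply: measurable_funS mxb => //; apply: subset_itvr; rewrite bnd_simp.
have abE : [set` `[a, b]] = [set` `[a, x]] `|` [set` `]x, b]].
  by rewrite -itv_bndbnd_setU// bnd_simp ltW.
have mab : measurable_fun `[a, b] f by rewrite abE; apply/measurable_funU.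
split=> //; rewrite abE ge0_integral_setU//=.
- rewrite big_ord_recl/=; congr (_ + _)%E.
    rewrite integral_itv_bndoo//.
    by apply/measurable_EFinP; exact: (mf 0%N isT).
  by rewrite -Ixb; apply: integral_itv_obnd_cbnd; exact/measurable_EFinP.
- by rewrite -abE; exact/measurable_EFinP.
- by move=> y _; rewrite lee_fin.
- rewrite disj_set2E; apply/eqP/seteqP; split=> // y [] /=.
  by rewrite !in_itv/= => /andP[_ yx] /andP[/(le_lt_trans yx)]; rewrite ltxx.
Qed.

Lemma primitive K a b : a < b -> {within `[a, b], continuous K} ->
  exists F, [/\ {within `[a, b], continuous F},
    forall x : R, x \in `]a, b[ -> is_derive x 1 F (K x) &
    (\int[mu]_(x in `]a, b[) (K x)%:E = (F b - F a)%:E)%E].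
Proof.
move=> ab cK.
have iK : mu.-integrable `[a, b] (EFin \o K).
  by apply: continuous_compact_integrable => //; exact: segment_compact.
have dF (x : R) : x \in `]a, b[ ->
    is_derive x 1 (fun y => (\int[mu]_(t in `[a, y]) K t)%R) (K x).
  move=> xab; move: (xab); rewrite in_itv/= => /andP[ax xb].
  have [|//||d dE] := @continuous_FTC1 R K (BLeft a) x b xb.
  - exact: iK.
  - exact: within_continuous_continuous ab cK xab.
  - by rewrite -dE derive1E; exact: derivableP.
exists (fun y => (\int[mu]_(t in `[a, y]) K t)%R); split=> //.
  exact: parameterized_integral_continuous (ltW ab) iK.
rewrite set_itv1 Rintegral_set1 subr0 /Rintegral fineK; last first.
  exact: integrable_fin_num.
apply/esym/integral_itv_bndoo.
have /measurable_int : mu.-integrable `]a, b[ (EFin \o K).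
  apply: integrableS iK => //.
  by apply: subset_itv; rewrite bnd_simp.
by [].
Qed.

Lemma increment_le F G F' G' a b : a <= b ->
  {within `[a, b], continuous F} -> {within `[a, b], continuous G} ->
  (forall x : R, x \in `]a, b[ -> is_derive x 1 F (F' x)) ->
  (forall x : R, x \in `]a, b[ -> is_derive x 1 G (G' x)) ->
  (forall x, x \in `]a, b[ -> F' x <= G' x) ->
  F b - F a <= G b - G a.
Proof.
rewrite le_eqVlt => /predU1P[->|ab] cF cG dF dG le_FG.
  by rewrite !subrr.
have cGF : {within `[a, b], continuous (fun x => G x - F x)}.
  by move=> x; apply: cvgB; [exact: cG|exact: cF].
have dGF (x : R) : x \in `]a, b[ ->
    is_derive x 1 (fun x => G x - F x) (G' x - F' x).
  by move=> xab; have := dG x xab; have := dF x xab => ? ?; exact: is_deriveB.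
have [c cab] := MVT ab dGF cGF.
have : 0 <= (G' c - F' c) * (b - a) by rewrite mulr_ge0 ?subr_ge0 ?le_FG// ltW.
by move=> + E; rewrite -E; lra.
Qed.

End IntegralsOnPieces.

Lemma integral_unit_cst (R : realType) (l : R) :
  (\int[lebesgue_measure]_(t in `[0%R, 1%R]) l%:E = l%:E)%E.
Proof.
have m1 : lebesgue_measure ([set` `[(0 : R), 1]] : set R) = 1%E.
  by rewrite lebesgue_measure_itv/= lte_fin ltr01 -EFinB subr0.
transitivity (l%:E * lebesgue_measure ([set` `[0%R, 1%R]] : set R))%E.
  exact: (integral_cst (@lebesgue_measure R) (measurable_itv `[(0 : R), 1]) l%:E).
by rewrite m1 mule1.
Qed.

(** * Chords of the Segre--Veronese manifold and angles of representatives *)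

Section LocalComparison.
Context {R : realType}.
Implicit Types (a b x c : R).

Lemma le_sqrt_sqr x b : x ^+ 2 <= b -> x <= Num.sqrt b.
Proof.
by move=> xb; rewrite (le_trans (ler_norm x))// -sqrtr_sqr ler_wsqrtr.
Qed.

Lemma mul_cos_le_sin a : 0 <= a <= pi / 2 -> a * cos a <= sin a.
Proof.
move=> /andP[a0 api].
have dF (x : R) : is_derive x 1 (fun y => y * cos y) (1 * cos x + x * - sin x).
  exact: is_derive_mul (is_derive_id x 1) (is_derive_cos x).
have := increment_le (F := fun x => x * cos x) (G := sin)
  (F' := fun x => 1 * cos x + x * - sin x) (G' := cos) a0.
rewrite sin0 mul0r !subr0; apply.
- by apply: derivable_within_continuous => x _; have := dF x => -[].
- by apply: derivable_within_continuous => x _; exact: derivable_sin.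
- move=> x; rewrite in_itv/= => /andP[x0 xa].
  suff : 0 <= x * sin x by lra.
  rewrite mulr_ge0 ?ltW// sin_gt0_pi// x0/=.
  by have := pi_gt0 R; lra.
Qed.

(** This bound, 1 + a^2 / 2 <= 1 / cos a, is sharp to second order at 0, as is
    needed to recover the exact length of a curve from its chords. *)
Lemma cos_mul_le1 a : 0 <= a <= pi / 2 -> cos a * (1 + a ^+ 2 / 2) <= 1.
Proof.
move=> /andP[a0 api].
pose F' x := - sin x * (1 + x ^+ 2 / 2) + cos x * x.
have dF (x : R) : is_derive x 1 (fun y => cos y * (1 + y ^+ 2 / 2)) (F' x).
  have Dsqr := is_derive_mul (is_derive_id x 1) (is_derive_id x 1).
  have Dhalf := is_derive_mul Dsqr (is_derive_cst (2^-1 : R) x 1).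
  have := is_derive_mul (is_derive_cos x)
    (is_derive_add (is_derive_cst (1 : R) x 1) Dhalf).
  by move=> D; apply: is_derive_eq D _; rewrite /F'/=; field.
have := increment_le (F := fun y => cos y * (1 + y ^+ 2 / 2))
  (G := fun=> 0) (F' := F') (G' := fun=> 0) a0.
rewrite cos0 expr0n/= mul0r addr0 mul1r subr0 subr_le0; apply.
- by apply: derivable_within_continuous => x _; have := dF x => -[].
- by move=> x; exact: cvg_cst.
- move=> x; rewrite in_itv/= => /andP[x0 xa]; rewrite /F'.
  have xpi : 0 <= x <= pi / 2 by lra.
  have := mul_cos_le_sin xpi.
  suff : 0 <= sin x * x ^+ 2 by nra.
  rewrite mulr_ge0 ?sqr_ge0// ltW// sin_gt0_pi// x0/=.
  by have := pi_gt0 R; lra.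
Qed.

Lemma bernoulli_prod (I : Type) (r : seq I) (c x : I -> R) :
  (forall i, 0 <= c i) -> (forall i, 0 <= x i) ->
  (forall i, c i * (1 + x i) <= 1) ->
  (\prod_(i <- r) c i) * (1 + \sum_(i <- r) x i) <= 1.
Proof.
move=> c0 x0 cx; elim: r => [|i r IH]; first by rewrite !big_nil addr0 mulr1.
rewrite !big_cons.
set C := \prod_(j <- r) c j in IH *; set S := \sum_(j <- r) x j in IH *.
have C0 : 0 <= C by apply: prodr_ge0.
have S0 : 0 <= S by apply: sumr_ge0.
apply: (@le_trans _ _ ((c i * (1 + x i)) * (C * (1 + S)))).
  have := mulr_ge0 (mulr_ge0 (c0 i) C0) (mulr_ge0 (x0 i) S0).
  by lra.
by apply: mulr_ile1 => //; rewrite mulr_ge0// ?addr_ge0.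
Qed.

End LocalComparison.

Section Representatives.
Context {R : realType} {d : nat} {n k : 'I_d -> nat}.
Implicit Types (p q r : pre_index n -> R) (X : tensor_index n k -> R).

Lemma MdistE p q : Mdist k p q =
  enorm (fun i => Num.sqrt (k i)%:R * angle (direction p i) (direction q i)).
Proof.
rewrite /Mdist /enorm /inner; congr Num.sqrt; apply: eq_bigr => i _.
by rewrite mulrACA -expr2 sqr_sqrtr ?ler0n// expr2.
Qed.

Lemma Mdist_ge0 p q : 0 <= Mdist k p q.
Proof. exact: sqrtr_ge0. Qed.

Lemma Mdist_triangle p q r : pre_SV R n p -> pre_SV R n q -> pre_SV R n r ->
  Mdist k p r <= Mdist k p q + Mdist k q r.
Proof.
move=> [_ p1] [_ q1] [_ r1]; rewrite !MdistE.
apply: le_trans (enorm_triangle _ _).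
apply: enorm_le => i; rewrite mulr_ge0 ?sqrtr_ge0 ?angle_ge0//=.
by rewrite -mulrDr ler_wpM2l ?sqrtr_ge0// angle_triangle.
Qed.

Lemma enorm_segre p : pre_SV R n p -> enorm (segre k p) = scal p.
Proof.
move=> [p0 p1]; rewrite segreE enorm_scale ?ltW//.
by rewrite usphere_utensor ?mulr1.
Qed.

Definition normalize {I : finType} (x : I -> R) : I -> R :=
  fun i => x i / enorm x.

Lemma normalize_segre p : pre_SV R n p ->
  normalize (segre k p) = utensor (direction p).
Proof.
move=> pP; rewrite /normalize enorm_segre// segreE; apply/funext => J.
by case: pP => p0 _; rewrite mulrAC mulfV ?mul1r ?gt_eqF.
Qed.

Lemma SV_enorm_gt0 X : SV R n k X -> 0 < enorm X.
Proof. by move=> [p pP <-]; rewrite enorm_segre//; case: pP. Qed.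

(** Flipping the signs of the directions of q so that they make acute angles
    with those of p multiplies the tensor of q by the sign of the inner product
    of the two tensors, which is positive here. *)
Lemma acute_representative p q : pre_SV R n p -> pre_SV R n q ->
  (forall i, 1 <= k i)%N ->
  0 < inner (utensor (k := k) (direction p)) (utensor (direction q)) ->
  exists2 q', representatives (segre k q) q' &
    forall i, 0 < inner (direction p i) (direction q' i).
Proof.
move=> pP [q0 q1] k1; rewrite inner_utensor => pq.
pose e i := Num.sg (inner (direction p i) (direction q i)).
pose q' : pre_index n -> R := fun x =>
  match x with inl _ => scal q | inr t => e (tag t) * q (inr t) end.
have dq' i : direction q' i = (fun j => e i * direction q i j) by [].
have pqi i : inner (direction p i) (direction q i) != 0.
  apply/negP => /eqP pqi; move: pq; rewrite (bigD1 i)//= pqi expr0n.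
  by rewrite eqn0Ngt (k1 i) mul0r ltxx.
have e2 i : e i * e i = 1.
  by rewrite /e -expr2 sqr_sg pqi.
have ek : \prod_i e i ^+ k i = 1.
  rewrite /e; under eq_bigr do rewrite -sgrX.
  by rewrite -(big_morph _ (@sgrM R) (@sgr1 R)) gtr0_sg.
exists q' => [|i]; last first.
  rewrite dq' inner_scaler /e -normrEsg normr_gt0; exact: pqi.
split; first split=> // i.
  apply/usphereE; rewrite dq' inner_scalel inner_scaler mulrA e2 mul1r.
  exact/usphereE.
rewrite !segreE; apply/funext => J; congr (_ * _).
rewrite /utensor /ptensor; under eq_bigr do rewrite dq'.
by rewrite big_split/= (prod_slot_cst e) ek mul1r.
Qed.

(** For acute angles a_i with cosines c_i the inner product of the unit tensors
    is the product of the c_i ^ k_i, so cos a (1 + a^2 / 2) <= 1 and Bernoulli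
    give (1 - x^2 / 2) (1 + M^2 / 2) <= 1 for x the chord and M = Mdist. *)
Lemma near_representative p X x : (forall i, 1 <= k i)%N ->
  pre_SV R n p -> SV R n k X -> 0 <= x <= 1 ->
  enorm (fun J => normalize X J - normalize (segre k p) J) <= x ->
  exists2 q, representatives X q & Mdist k p q <= x * (1 + x).
Proof.
move=> k1 pP [q qP <-] /andP[x0 x1]; rewrite !normalize_segre//.
set u := utensor (direction q); set w := utensor (direction p) => ux.
have /usphereE uu : usphere u by apply: usphere_utensor; case: qP.
have /usphereE ww : usphere w by apply: usphere_utensor; case: pP.
have xwu : 1 - x ^+ 2 / 2 <= inner w u.
  have : enorm (fun J => u J - w J) ^+ 2 <= x ^+ 2.
    by rewrite ler_sqr ?nnegrE ?enorm_ge0.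
  rewrite enorm_sqr (_ : (fun J => _) = (fun J => 1 * u J + (-1) * w J)).
    by rewrite inner_lincombl !inner_lincombr uu ww (innerC u w); lra.
  by apply/funext => J; rewrite mul1r mulN1r.
have wu0 : 0 < inner w u by have : x ^+ 2 <= 1; [rewrite expr_le1|lra].
have [q' [q'P q'q] acute] := acute_representative pP qP k1 wu0.
exists q' => //.
have [_ p1] := pP; have [_ q'1] := q'P.
pose a i := angle (direction p i) (direction q' i).
have a0 i : 0 <= a i by exact: angle_ge0.
have aE i : cos (a i) = inner (direction p i) (direction q' i) by exact: cos_angle.
have api i : a i <= pi / 2.
  rewrite leNgt; apply/negP => pia; have := acute i.
  suff : cos (a i) < cos (pi / 2).
    by rewrite cos_pihalf aE => /lt_trans/[apply]; rewrite ltxx.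
  have := pi_gt0 R; have ? : a i <= pi by exact: angle_lepi.
  by move=> ?; rewrite ltr_cos// in_itv/= ?a0//; lra.
have wE : inner w u = \prod_(s : slot (k := k)) cos (a (tag s)).
  rewrite (prod_slot_cst (fun i => cos (a i))).
  have -> : u = utensor (direction q').
    by rewrite /u -!normalize_segre// q'q.
  by rewrite inner_utensor; apply: eq_bigr => i _; rewrite aE.
have ME : Mdist k p q' ^+ 2 / 2 = \sum_(s : slot (k := k)) a (tag s) ^+ 2 / 2.
  rewrite (sum_slot_cst (fun i => a i ^+ 2 / 2)) /Mdist sqr_sqrtr.
    by rewrite mulr_suml; apply: eq_bigr => i _; rewrite mulrA.
  by apply: sumr_ge0 => i _; rewrite mulr_ge0 ?sqr_ge0.
have : inner w u * (1 + Mdist k p q' ^+ 2 / 2) <= 1.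
  rewrite wE ME; apply: bernoulli_prod => s.
  - by rewrite aE ltW.
  - by rewrite divr_ge0 ?sqr_ge0.
  - by rewrite cos_mul_le1 ?a0 ?api.
set m := Mdist k p q' => wm.
have m0 : 0 <= m by exact: Mdist_ge0.
have {wm xwu}xm : (1 - x ^+ 2 / 2) * (1 + m ^+ 2 / 2) <= 1.
  apply: le_trans wm; rewrite ler_wpM2r// addr_ge0// divr_ge0 ?sqr_ge0//.
have x2 : x ^+ 2 <= 1 by rewrite expr_le1.
have m2 : m ^+ 2 <= 2 * x ^+ 2 by have := sqr_ge0 m; nra.
rewrite -ler_sqr ?nnegrE ?mulr_ge0 ?addr_ge0//.
have {xm}xm : m ^+ 2 <= x ^+ 2 + x ^+ 2 * m ^+ 2 / 2 by lra.
have : m ^+ 2 <= x ^+ 2 + x ^+ 2 * x ^+ 2.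
  apply: le_trans xm _; rewrite lerD2l -mulrA ler_wpM2l ?sqr_ge0//; lra.
have : 0 <= x ^+ 3 by rewrite exprn_ge0.
by rewrite exprMn; lra.
Qed.

End Representatives.

(** * Arcs that avoid the origin *)

Section CurvePieces.
Context {R : realType} {I : finType}.

Lemma continuous_inner (x y : R -> I -> R) (t : R) :
  (forall i, {for t, continuous (fun s => x s i)}) ->
  (forall i, {for t, continuous (fun s => y s i)}) ->
  {for t, continuous (fun s => inner (x s) (y s))}.
Proof.
move=> cx cy; rewrite /continuous_at /inner; apply: cvg_big => //.
  by move=> ? ?; exact: add_continuous.
by move=> i _; apply: cvgM; [exact: cx|exact: cy].
Qed.

Lemma continuous_sqrt (f : R -> R) (t : R) : {for t, continuous f} ->
  {for t, continuous (fun s => Num.sqrt (f s))}.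
Proof.
by move=> cf; apply: continuous_comp cf _; exact: sqrt_continuous.
Qed.

Variables (h h' : R -> I -> R) (a b : R).
Hypothesis ab : a < b.
Hypothesis h_gt0 : forall t : R, t \in `[a, b] -> 0 < enorm (h t).
Hypothesis dh : forall t : R, vderive h t (h' t).
Hypothesis ch' : forall (t : R) i, {for t, continuous (fun s => h' s i)}.

Let w s := normalize (h s).
Let w' s := angular_part (h s) (h' s).

Let sub (t : R) : t \in `]a, b[ -> t \in `[a, b].
Proof. exact: subset_itv_oo_cc. Qed.

Let dw (t : R) : t \in `[a, b] -> vderive w t (w' t).
Proof. by move=> /h_gt0 ht; exact: vderive_normalize. Qed.

Let cw (t : R) : t \in `[a, b] -> forall i, {for t, continuous (fun s => w s i)}.
Proof. by move=> /dw wt i; exact: is_derive_continuous (wt i). Qed.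

Let cr (t : R) : t \in `[a, b] -> {for t, continuous (fun s => enorm (h s))}.
Proof.
by move=> /h_gt0 ht; exact: is_derive_continuous (vderive_enorm ht (@dh t)).
Qed.

Let crad (t : R) : t \in `[a, b] ->
  {for t, continuous (fun s => radial_part (h s) (h' s))}.
Proof. by move=> /cw wt; apply: continuous_inner. Qed.

Let cw' (t : R) : t \in `[a, b] -> forall i, {for t, continuous (fun s => w' s i)}.
Proof.
move=> tab i; apply: cvgM.
  apply: cvgB; first exact: ch'.
  by apply: cvgM; [exact: crad|exact: cw].
by apply: cvgV; [rewrite gt_eqF ?h_gt0|exact: cr].
Qed.

Let within_continuous (f : R -> R) :
  (forall t : R, t \in `[a, b] -> {for t, continuous f}) ->
  {within `[a, b], continuous f}.
Proof. by move=> cf; apply: continuous_in_subspaceT => t; rewrite inE; exact: cf. Qed.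

Lemma within_continuous_warped_speed (alpha : R) : {within `[a, b], continuous
  (fun t => Num.sqrt (warped_metric alpha (h t) (h' t) (h' t)))}.
Proof.
apply: within_continuous => t tab; apply: continuous_sqrt.
apply: cvgD; first by apply: cvgM; exact: crad.
apply: cvgM; last by apply: continuous_inner; exact: cw'.
by apply: cvgM; apply: cvgM; (exact: cvg_cst || exact: cr).
Qed.

Lemma within_continuous_angular_speed :
  {within `[a, b], continuous (fun t => enorm (w' t))}.
Proof.
apply: within_continuous => t tab; apply: continuous_sqrt.
by apply: continuous_inner; exact: cw'.
Qed.

Variable Lam : R -> R.
Hypothesis cLam : {within `[a, b], continuous Lam}.
Hypothesis dLam : forall t : R, t \in `]a, b[ -> is_derive t 1 Lam (enorm (w' t)).

Let within_sub (f : R -> R) (s t : R) : s \in `[a, b] -> t \in `[a, b] ->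
  {within `[a, b], continuous f} -> {within `[s, t], continuous f}.
Proof.
move=> sab tab; apply: continuous_subspaceW; apply: subset_itvScc.
- by move: sab; rewrite in_itv/= bnd_simp => /andP[].
- by move: tab; rewrite in_itv/= bnd_simp => /andP[].
Qed.

Let itv_sub (s t x : R) : s \in `[a, b] -> t \in `[a, b] -> x \in `]s, t[ ->
  x \in `]a, b[.
Proof. by rewrite !in_itv/=; lra. Qed.

(** A chord is at most as long as the arc: the component of the curve along
    the chord grows at most as fast as its arc length. *)
Lemma chord_le_arc (s t : R) : s \in `[a, b] -> t \in `[a, b] -> s <= t ->
  enorm (fun i => w t i - w s i) <= Lam t - Lam s.
Proof.
move=> sab tab st; set D := fun i => _; set e := enorm D.
have ninc : e * Lam s <= e * Lam t /\ Lam s <= Lam t.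
  have : Lam s <= Lam t.
    have c0 : {within `[s, t], continuous (fun=> 0 : R)}.
      by move=> x; exact: cvg_cst.
    have d0 (x : R) : x \in `]s, t[ -> is_derive x 1 (fun=> 0 : R) 0.
      by move=> _; exact: is_derive_cst.
    have dL (x : R) : x \in `]s, t[ -> is_derive x 1 Lam (enorm (w' x)).
      by move=> /(itv_sub sab tab)/dLam.
    have := increment_le st c0 (within_sub sab tab cLam) d0 dL
      (fun x _ => enorm_ge0 (w' x)).
    by rewrite subr0 subr_ge0.
  by move=> le_st; rewrite ler_wpM2l ?enorm_ge0.
have dF (x : R) : x \in `[a, b] ->
    is_derive x 1 (fun y => inner (w y) D) (inner (w' x) D).
  move=> xab; have dD : vderive (fun=> D) x (fun=> 0).
    by move=> i; exact: is_derive_cst.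
  apply: is_derive_eq (vderive_inner (dw xab) dD) _.
  by rewrite [X in _ + X]big1 ?addr0// => i _; rewrite mulr0.
have : inner (w t) D - inner (w s) D <= e * Lam t - e * Lam s.
  have cF : {within `[s, t], continuous (fun y => inner (w y) D)}.
    apply: within_sub => //; apply: within_continuous => x /dF.
    exact: is_derive_continuous.
  have cG : {within `[s, t], continuous (fun y => e * Lam y)}.
    by apply: within_sub => // x; apply: cvgM; [exact: cvg_cst|exact: cLam].
  have dF' (x : R) : x \in `]s, t[ ->
      is_derive x 1 (fun y => inner (w y) D) (inner (w' x) D).
    by move=> /(itv_sub sab tab)/sub/dF.
  have dG (x : R) : x \in `]s, t[ ->
      is_derive x 1 (fun y => e * Lam y) (e * enorm (w' x)).
    move=> /(itv_sub sab tab)/dLam dx.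
    apply: is_derive_eq (is_derive_mul (is_derive_cst e x 1) dx) _.
    by rewrite mul0r add0r.
  apply: (increment_le st cF cG dF' dG) => x _.
  by rewrite mulrC cauchy_schwarz.
have -> : inner (w t) D - inner (w s) D = e ^+ 2.
  rewrite enorm_sqr /D (_ : (fun i => _) = (fun i => 1 * w t i + (-1) * w s i)).
    by rewrite !inner_lincombr !inner_lincombl; ring.
  by apply/funext => i; rewrite mul1r mulN1r.
have [e0|e0] := eqVneq e 0; first by rewrite e0 subr_ge0; case: ninc.
have {}e0 : 0 < e by rewrite lt_neqAle eq_sym e0 enorm_ge0.
by rewrite -mulrBr expr2 ler_pM2l.
Qed.

(** The radius together with the angle phi, whose speed c |w'| is at most
    alpha |w'|, describes a plane curve that is not longer than h; the left
    hand side is the increment of its component along the unit vector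
    (C, -S). *)
Lemma plane_increment_le (alpha c phi C S : R) (G : R -> R) :
  0 <= c <= alpha -> C ^+ 2 + S ^+ 2 = 1 ->
  {within `[a, b], continuous G} ->
  (forall t : R, t \in `]a, b[ ->
    is_derive t 1 G (Num.sqrt (warped_metric alpha (h t) (h' t) (h' t)))) ->
  let psi := phi + c * (Lam b - Lam a) in
  enorm (h b) * (C * cos psi - S * sin psi) -
  enorm (h a) * (C * cos phi - S * sin phi) <= G b - G a.
Proof.
move=> /andP[c0 calpha] CS cG dG /=.
pose psi t := phi + c * (Lam t - Lam a).
pose F t := enorm (h t) * (C * cos (psi t) - S * sin (psi t)).
pose F' t := radial_part (h t) (h' t) * (C * cos (psi t) - S * sin (psi t)) +
  enorm (h t) * (C * (- sin (psi t) * (c * enorm (w' t))) -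
                 S * (cos (psi t) * (c * enorm (w' t)))).
have dpsi (t : R) : t \in `]a, b[ -> is_derive t 1 psi (c * enorm (w' t)).
  move=> /dLam dL.
  have dB := is_derive_add dL (is_derive_cst (- Lam a) t 1).
  have := is_derive_add (is_derive_cst phi t 1)
    (is_derive_mul (is_derive_cst c t 1) dB).
  by move=> D; apply: is_derive_eq D _; rewrite /=; ring.
have dF (t : R) : t \in `]a, b[ -> is_derive t 1 F (F' t).
  move=> tab; have dt := dpsi _ tab.
  have dcos : is_derive t 1 (fun s => cos (psi s)) _ :=
    is_derive1_comp (is_derive_cos (psi t)) dt.
  have dsin : is_derive t 1 (fun s => sin (psi s)) _ :=
    is_derive1_comp (is_derive_sin (psi t)) dt.
  have := is_derive_mul (vderive_enorm (h_gt0 (sub tab)) (@dh t))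
    (is_derive_add (is_derive_mul (is_derive_cst C t 1) dcos)
                   (is_derive_mul (is_derive_cst (- S) t 1) dsin)).
  rewrite (_ : (fun s => _) = F); last first.
    by apply/funext => s; rewrite /F /= mulNr.
  by move=> D; apply: is_derive_eq D _; rewrite /F' /=; ring.
have cpsi : {within `[a, b], continuous psi}.
  move=> x; apply: cvgD; first exact: cvg_cst.
  apply: cvgM; first exact: cvg_cst.
  by apply: cvgB; [exact: cLam|exact: cvg_cst].
have cF : {within `[a, b], continuous F}.
  move=> x; apply: cvgM.
    by apply: within_continuous => t; exact: cr.
  apply: cvgB; (apply: cvgM; first exact: cvg_cst).
    by apply: continuous_comp (cpsi x) _; exact: continuous_cos.
  by apply: continuous_comp (cpsi x) _; exact: continuous_sin.
have -> : enorm (h a) * (C * cos phi - S * sin phi) = F a.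
  by rewrite /F /psi subrr mulr0 addr0.
apply: (increment_le (ltW ab) cF cG dF dG) => t tab.
apply: le_sqrt_sqr.
rewrite /warped_metric -/(w' t) -enorm_sqr /F'.
set A := radial_part _ _; set r := enorm (h t); set v := enorm (w' t).
have : cos (psi t) ^+ 2 + sin (psi t) ^+ 2 = 1 by exact: cos2Dsin2.
move: (cos (psi t)) (sin (psi t)) => x y xy.
pose X := C * x - S * y; pose Y := C * y + S * x.
have XY : X ^+ 2 + Y ^+ 2 = 1.
  rewrite (_ : _ + _ = (C ^+ 2 + S ^+ 2) * (x ^+ 2 + y ^+ 2)).
    by rewrite CS xy mulr1.
  by rewrite /X /Y; ring.
have -> : A * (C * x - S * y) + r * (C * (- y * (c * v)) - S * (x * (c * v))) =
    A * X - r * c * v * Y by rewrite /X /Y; ring.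
apply: (@le_trans _ _ (A ^+ 2 + (r * c * v) ^+ 2)).
  have -> : A ^+ 2 + (r * c * v) ^+ 2 =
      (X ^+ 2 + Y ^+ 2) * (A ^+ 2 + (r * c * v) ^+ 2) by rewrite XY mul1r.
  rewrite -subr_ge0 (_ : _ - _ = (A * Y + r * c * v * X) ^+ 2) ?sqr_ge0//.
  by ring.
rewrite expr2 lerD2l !exprMn [alpha ^+ 2 * _]mulrC !ler_wpM2r ?sqr_ge0//.
rewrite ler_wpM2l ?sqr_ge0// ler_sqr// nnegrE; lra.
Qed.

End CurvePieces.

(** * Smooth pieces of curves in the Segre--Veronese manifold *)

Section Arcs.
Context {R : realType} {d : nat} {n k : 'I_d -> nat}.
Implicit Types (p q : pre_index n -> R) (h : R -> tensor_index n k -> R).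

(** Cut the arc into parts that are so short that near_representative applies
    with a factor at most 1 + eps, and concatenate. *)
Lemma arc_representative h (Lam : R -> R) (a b eps : R) p :
  (forall i, 1 <= k i)%N -> a <= b -> 0 < eps ->
  (forall t : R, t \in `[a, b] -> SV R n k (h t)) ->
  {within `[a, b], continuous Lam} ->
  (forall s t : R, s \in `[a, b] -> t \in `[a, b] -> s <= t ->
    enorm (fun i => normalize (h t) i - normalize (h s) i) <= Lam t - Lam s) ->
  representatives (h a) p ->
  exists2 q, representatives (h b) q &
    Mdist k p q <= (1 + eps) * (Lam b - Lam a).
Proof.
move=> k1 ab eps0 hSV cLam chord.
pose del := Num.min eps 1.
have del0 : 0 < del by rewrite lt_min eps0 ltr01.
have dele : del <= eps by rewrite ge_min lexx.
have del1 : del <= 1 by rewrite ge_min lexx orbT.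
have short s t p' : s \in `[a, b] -> t \in `[a, b] -> s <= t ->
    Lam t - Lam s <= del -> representatives (h s) p' ->
    exists2 q, representatives (h t) q &
      Mdist k p' q <= (1 + eps) * (Lam t - Lam s).
  move=> sab tab st lst [pP pE].
  have ch := chord _ _ sab tab st.
  have x0 : 0 <= Lam t - Lam s := le_trans (enorm_ge0 _) ch.
  rewrite -pE in ch.
  have x01 : 0 <= Lam t - Lam s <= 1 by rewrite x0 (le_trans lst).
  have [q qP pq] := near_representative k1 pP (hSV _ tab) x01 ch.
  exists q => //; apply: le_trans pq _; rewrite mulrC ler_wpM2r//.
  by rewrite lerD2l (le_trans lst).
have long N s t p' : s \in `[a, b] -> t \in `[a, b] -> s <= t ->
    Lam t - Lam s <= N%:R * del -> representatives (h s) p' ->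
    exists2 q, representatives (h t) q &
      Mdist k p' q <= (1 + eps) * (Lam t - Lam s).
  elim: N s p' => [|N IH] s p' sab tab st lst pP.
    by apply: short => //; apply: le_trans lst _; rewrite mul0r ltW.
  have [|/ltW lt_del] := leP (Lam t - Lam s) del; first by move=> ?; exact: short.
  have [||c cst cE] := @IVT _ Lam s t (Lam s + del) st.
  - apply: continuous_subspaceW cLam; apply: subset_itvScc.
    + by move: sab; rewrite in_itv/= bnd_simp => /andP[].
    + by move: tab; rewrite in_itv/= bnd_simp => /andP[].
  - by rewrite ge_min le_max; apply/andP; split; apply/orP; [left|right]; lra.
  have [sc ct] : s <= c /\ c <= t by move: cst; rewrite in_itv/= => /andP.
  have cab : c \in `[a, b] by move: sab tab; rewrite !in_itv/=; lra.
  have [|q qP p'q] := short s c p' sab cab sc _ pP; first by rewrite cE; lra.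
  have [|r rP qr] := IH c q cab tab ct _ qP.
    by rewrite cE; move: lst; rewrite -natr1 mulrDl mul1r; lra.
  exists r => //; apply: le_trans (Mdist_triangle pP.1 qP.1 rP.1) _.
  by apply: le_trans (lerD p'q qr) _; rewrite -mulrDr; lra.
move=> pP; have [N] : exists N : nat, (Lam b - Lam a) / del <= N%:R.
  exists (Num.truncn ((Lam b - Lam a) / del)).+1.
  exact/ltW/truncnS_gt.
rewrite ler_pdivrMr// => LN.
by apply: (long N) => //; rewrite in_itv/= ?lexx ?ab.
Qed.

End Arcs.

Section Curves.
Context {R : realType}.
Notation mu := lebesgue_measure.

Lemma smooth_piece {I : finType} (c : R -> I -> R) (a b : R) :
  (forall i, exists2 h : R -> R, smooth h &
     forall t : R, t \in `[a, b] -> c t i = h t) ->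
  exists h : R -> I -> R, [/\ (forall i, smooth (h^~ i)),
    (forall t : R, t \in `[a, b] -> c t = h t) &
    (forall t : R, t \in `]a, b[ -> velocity c t = velocity h t)].
Proof.
move=> /(_ _)/cid2 hc; pose h t i := sval (hc i) t.
have ch (t : R) : t \in `[a, b] -> c t = h t.
  by move=> tab; apply/funext => i; rewrite /h; case: (hc i) => /= g _ /(_ t tab).
exists h; split=> // [i|t tab]; first by rewrite /h; case: (hc i).
apply: (velocity_near (e := h)).
  by move=> i; apply: smooth_is_derive; rewrite /h; case: (hc i).
near=> s; apply: ch; apply: subset_itv_oo_cc.
by near: s; exact: near_in_itvoo.
Unshelve. all: by end_near. Qed.

Context {d : nat} {n k : 'I_d -> nat}.

Definition warped_speed (alpha : R) (c : R -> tensor_index n k -> R) (t : R) : R :=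
  Num.sqrt (warped_metric alpha (c t) (velocity c t) (velocity c t)).

(** Here l is the length of the piece and L the length of its projection to the
    unit sphere. Both bounds are in a form that can be added over the pieces:
    the representative of the end point of one piece is the starting one for
    the next piece, and so is the angle psi. *)
Lemma curve_piece (alpha : R) (c : R -> tensor_index n k -> R) (a b : R) :
  (forall i, 1 <= k i)%N -> a < b ->
  (forall i, exists2 h : R -> R, smooth h &
     forall t : R, t \in `[a, b] -> c t i = h t) ->
  (forall t : R, t \in `[a, b] -> SV R n k (c t)) ->
  measurable_fun `]a, b[ (warped_speed alpha c) /\
  exists l L : R, [/\
    (\int[mu]_(t in `]a, b[) (warped_speed alpha c t)%:E = l%:E)%E,
    (forall eps p, 0 < eps -> representatives (c a) p ->
       exists2 q, representatives (c b) q & Mdist k p q <= (1 + eps) * L) &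
    (forall m phi C S, 0 <= m <= alpha -> C ^+ 2 + S ^+ 2 = 1 ->
       let psi := phi + m * L in
       enorm (c b) * (C * cos psi - S * sin psi) -
       enorm (c a) * (C * cos phi - S * sin phi) <= l)].
Proof.
move=> k1 ab csm cSV; have [h [hsm ch vh]] := smooth_piece csm.
have aab : a \in `[a, b] by rewrite in_itv/= lexx ltW.
have bab : b \in `[a, b] by rewrite in_itv/= lexx ltW.
have h_gt0 (t : R) : t \in `[a, b] -> 0 < enorm (h t).
  by move=> tab; rewrite -ch//; apply: SV_enorm_gt0; exact: cSV.
have dh (t : R) : vderive h t (velocity h t).
  by move=> i; exact: smooth_is_derive.
have ch' (t : R) i : {for t, continuous (fun s => velocity h s i)}.
  apply: is_derive_continuous; apply: smooth_is_derive.
  exact: smooth_derive1.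
have cspeed := within_continuous_warped_speed (alpha := alpha) h_gt0 dh ch'.
have speedE : {in `]a, b[, warped_speed alpha c =1 warped_speed alpha h}.
  move=> t tab; rewrite /warped_speed vh// ch//.
  exact: subset_itv_oo_cc tab.
split.
  apply: (eq_measurable_fun (warped_speed alpha h)).
    by move=> t; rewrite inE/= => tab; rewrite speedE.
  apply: (@measurable_funS _ _ _ _ `[a, b]) => //.
    exact: subset_itv_oo_cc.
  exact: subspace_continuous_measurable_fun.
have [Lam [cLam dLam _]] := primitive ab
  (within_continuous_angular_speed h_gt0 dh ch').
have [G [cG dG IG]] := primitive ab cspeed.
have chord := chord_le_arc h_gt0 dh cLam dLam.
exists (G b - G a), (Lam b - Lam a); split.
- rewrite -IG; apply: eq_integral => t; rewrite inE/= => tab.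
  by rewrite speedE.
- move=> eps p eps0; rewrite !ch//; apply: arc_representative => //.
    exact: ltW.
  by move=> t tab; rewrite -ch//; exact: cSV.
- move=> m phi C S malpha CS; rewrite !ch//.
  exact: (plane_increment_le ab h_gt0 dh cLam dLam phi malpha CS cG dG).
Qed.

End Curves.

(** * Polar coordinates in the plane *)

Section PlanarDistance.
Context {R : realType}.

(** The planar distance between points with polar coordinates (la, phi) and
    (m, phi + th), by the law of cosines. *)
Definition cone_dist (la m th : R) : R :=
  Num.sqrt (la ^+ 2 - 2 * la * m * cos th + m ^+ 2).

(** The length of a planar vector is the maximum of its components along unit
    vectors, here (C, -S). The bounds on the components, unlike the distances
    themselves, can be added along a subdivided curve. *)
Lemma cone_dist_le (la m th l : R) :
  (forall C S, C ^+ 2 + S ^+ 2 = 1 ->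
    m * (C * cos th - S * sin th) - la * C <= l) ->
  cone_dist la m th <= l.
Proof.
move=> le_l; have cs : cos th ^+ 2 + sin th ^+ 2 = 1 := cos2Dsin2 th.
set x := m * cos th - la; set y := m * sin th.
have xy : la ^+ 2 - 2 * la * m * cos th + m ^+ 2 = x ^+ 2 + y ^+ 2.
  have m2 : m ^+ 2 = m ^+ 2 * (cos th ^+ 2 + sin th ^+ 2) by rewrite cs mulr1.
  by rewrite [X in _ + X = _]m2 /x /y; ring.
rewrite /cone_dist xy; set f := Num.sqrt _.
have f2 : f ^+ 2 = x ^+ 2 + y ^+ 2 by rewrite sqr_sqrtr ?addr_ge0 ?sqr_ge0.
have [f0|f0] := eqVneq f 0.
  have /= := le_l 1 0; have /= := le_l (-1) 0.
  by rewrite f0 sqrrN expr1n expr0n addr0 => /(_ erefl) + /(_ erefl); lra.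
have := le_l (x / f) (- (y / f)); rewrite sqrrN !expr_div_n -mulrDl -f2.
rewrite mulfV ?expf_neq0// => /(_ erefl).
rewrite (_ : _ - _ = (x ^+ 2 + y ^+ 2) / f); last first.
  by rewrite /x /y; ring.
by rewrite -f2 expr2 mulfK.
Qed.

End PlanarDistance.

(** * The distance of the Segre--Veronese manifold *)

Section PiecewiseCurves.
Context {R : realType}.
Notation mu := lebesgue_measure.

Lemma itv_partition_lt (a b : R) s j : itv_partition a b s -> (j < size s)%N ->
  nth 0 (a :: s) j < nth 0 (a :: s) j.+1.
Proof. by move=> [/pathP + _] => /(_ 0)/[apply]. Qed.

Lemma itv_partition_sub (a b : R) s j (t : R) : itv_partition a b s ->
  (j < size s)%N -> t \in `[nth 0 (a :: s) j, nth 0 (a :: s) j.+1] ->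
  t \in `[a, b].
Proof.
move=> abs js; rewrite !(set_nth_default b 0)//=; last exact: ltnW.
rewrite !in_itv/= => /andP[jt tj]; apply/andP; split.
  by apply: le_trans jt; apply: (itv_partition_nth_ge _ abs); rewrite ltnS ltnW.
by apply: (le_trans tj); apply: (@itv_partition_nth_le _ _ a b s j.+1).
Qed.

Context {d : nat} {n k : 'I_d -> nat}.
Implicit Types (p q : pre_index n -> R) (c : R -> tensor_index n k -> R).

Lemma warped_speed_measurable (alpha : R) c (s : seq R) :
  (forall i, 1 <= k i)%N -> itv_partition 0 1 s ->
  (forall (j : nat), (j < size s)%N -> forall i : tensor_index n k,
      exists2 h : R -> R, smooth h &
        forall t : R, t \in `[nth 0 (0 :: s) j, nth 0 (0 :: s) j.+1] ->
          c t i = h t) ->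
  (forall t : R, t \in `[0, 1] -> SV R n k (c t)) ->
  forall j, (j < size s)%N ->
    measurable_fun `]nth 0 (0 :: s) j, nth 0 (0 :: s) j.+1[
      (warped_speed alpha c).
Proof.
move=> k1 s01 csm cSV j js.
have [] // := curve_piece alpha k1 (itv_partition_lt s01 js) (csm j js).
by move=> t tj; apply: cSV; exact: itv_partition_sub s01 js tj.
Qed.

Lemma curve_total (alpha : R) c : (forall i, 1 <= k i)%N ->
  piecewise_smooth c -> (forall t : R, t \in `[0, 1] -> SV R n k (c t)) ->
  exists l L : R, [/\
    curve_length (warped_metric alpha) c = l%:E,
    (forall eps p, 0 < eps -> representatives (c 0) p ->
       exists2 q, representatives (c 1) q & Mdist k p q <= (1 + eps) * L) &
    (forall m C S, 0 <= m <= alpha -> C ^+ 2 + S ^+ 2 = 1 ->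
       enorm (c 1) * (C * cos (m * L) - S * sin (m * L)) -
       enorm (c 0) * C <= l)].
Proof.
move=> k1 [s [s01 csm]] cSV.
pose brk j : R := nth 0 (0 :: s) j.
have piece (j : nat) : exists lL : R * R, (j < size s)%N -> [/\
    (\int[mu]_(t in `]brk j, brk j.+1[) (warped_speed alpha c t)%:E = lL.1%:E)%E,
    (forall eps p, 0 < eps -> representatives (c (brk j)) p ->
       exists2 q, representatives (c (brk j.+1)) q &
         Mdist k p q <= (1 + eps) * lL.2) &
    (forall m phi C S, 0 <= m <= alpha -> C ^+ 2 + S ^+ 2 = 1 ->
       let psi := phi + m * lL.2 in
       enorm (c (brk j.+1)) * (C * cos psi - S * sin psi) -
       enorm (c (brk j)) * (C * cos phi - S * sin phi) <= lL.1)].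
  have [js|_] := boolP (j < size s)%N; last by exists (0, 0).
  have [|_ [l [L [lE rep pl]]]] :=
    curve_piece alpha k1 (itv_partition_lt s01 js) (csm j js).
    by move=> t tj; apply: cSV; exact: itv_partition_sub s01 js tj.
  by exists (l, L).
have [lL lLP] := choice piece.
pose l m := \sum_(j < m) (lL j).1; pose L m := \sum_(j < m) (lL j).2.
have brk_last : brk (size s) = 1.
  by have := itv_partition_nth_size 0 s01.
exists (l (size s)), (L (size s)); split.
- rewrite /curve_length.
  have [_ ->] := integral_itv_partition s01 (fun t => sqrtr_ge0 _)
    (warped_speed_measurable alpha k1 s01 csm cSV).
  rewrite /l -sumEFin; apply: eq_bigr => j _.
  by have [-> _ _] := lLP j (ltn_ord j).
- move=> eps p eps0 pP.
  suff /(_ _ (leqnn _)) : forall m, (m <= size s)%N ->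
      exists2 q, representatives (c (brk m)) q & Mdist k p q <= (1 + eps) * L m.
    by rewrite brk_last.
  elim=> [_|m IH ms].
    exists p => //; rewrite /L big_ord0 mulr0 /Mdist big1 ?sqrtr0// => i _.
    have [[_ p1] _] := pP; rewrite /angle.
    by have /usphereE -> := p1 i; rewrite acos1 expr0n mulr0.
  have [q qP pq] := IH (ltnW ms).
  have [_ rep _] := lLP m ms; have [r rP qr] := rep eps q eps0 qP.
  exists r => //; apply: le_trans (Mdist_triangle pP.1 qP.1 rP.1) _.
  by apply: le_trans (lerD pq qr) _; rewrite -mulrDr /L big_ord_recr.
- move=> m C S malpha CS.
  suff /(_ _ (leqnn _)) : forall N, (N <= size s)%N ->
      enorm (c (brk N)) * (C * cos (m * L N) - S * sin (m * L N)) -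
      enorm (c 0) * C <= l N by rewrite brk_last.
  elim=> [_|N IH Ns].
    by rewrite /L /l !big_ord0 mulr0 cos0 sin0 mulr1 mulr0 subr0 subrr.
  have {}IH := IH (ltnW Ns).
  have [_ _ pl] := lLP N Ns; have := pl m (m * L N) C S malpha CS.
  rewrite /= -mulrDr [in X in _ -> X]/L [in X in _ -> X]/l !big_ord_recr/=.
  rewrite -/(L N) -/(l N).
  by move: IH; lra.
Qed.

Lemma cone_dist_le_dist_SV (alpha : R) P Q p q :
  (forall i, 1 <= k i)%N -> 0 < alpha -> matched (k := k) P Q p q ->
  ((cone_dist (scal p) (scal q) (alpha * Mdist k p q))%:E <=
   dist_SV alpha P Q)%E.
Proof.
move=> k1 alpha0 [[pP pE] [qP qE] Mmin].
apply: le_ereal_inf_tmp => _ [c [csm cSV c0 c1] <-].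
have [l [L [-> rep pl]]] := curve_total alpha k1 csm cSV.
rewrite lee_fin.
have ML : Mdist k p q <= L.
  apply/ler_addgt0Pr => e e0.
  have [|L0] := leP L 0.
    move=> L0; have [|r rP pr] := rep 1 p ltr01; first by rewrite c0.
    have := Mmin p r (conj pP pE); rewrite -c1 => /(_ rP).
    by have := Mdist_ge0 (k := k) p q; lra.
  have [||r rP pr] := rep (e / L) p; [by rewrite divr_gt0|by rewrite c0|].
  have := Mmin p r (conj pP pE); rewrite -c1 => /(_ rP) /le_trans; apply.
  by apply: le_trans pr _; rewrite mulrDl mul1r divfK ?gt_eqF.
have M0 := Mdist_ge0 (k := k) p q.
(* Only the total angle alpha M, not alpha L, gives the bound, since the planar
   distance increases with the angle only up to pi: so alpha is replaced by
   m = alpha M / L. *)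
have [m malpha mE] : exists2 m, 0 <= m <= alpha & m * L = alpha * Mdist k p q.
  have [L0|L0] := eqVneq L 0.
    exists 0; first by rewrite lexx ltW.
    suff -> : Mdist k p q = 0 by rewrite mul0r mulr0.
    by apply/eqP; rewrite eq_le M0 -L0 ML.
  have {}L0 : 0 < L by rewrite lt_neqAle eq_sym L0 (le_trans M0).
  exists (alpha * Mdist k p q / L); last by rewrite divfK ?gt_eqF.
  apply/andP; split; first by rewrite divr_ge0 ?mulr_ge0 ?(ltW alpha0) ?(ltW L0).
  by rewrite ler_pdivrMr// ler_wpM2l// ltW.
apply: cone_dist_le => C S CS; have := pl m C S malpha CS.
by rewrite mE c0 c1 -pE -qE !enorm_segre.
Qed.

(** segre maps curves to curves of the same length. *)
Lemma dist_SV_le_dist_pre_SV (alpha : R) p q : (forall i, 1 <= k i)%N ->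
  (dist_SV alpha (segre k p) (segre k q) <= dist_pre_SV k alpha p q)%E.
Proof.
move=> k1; apply: le_ereal_inf_tmp => _ [c [[s [s01 csm]] cpre c0 c1] <-].
pose e := fun t => segre k (c t).
have esm (j : nat) : (j < size s)%N -> forall i : tensor_index n k,
    exists2 h : R -> R, smooth h &
      forall t : R, t \in `[nth 0 (0 :: s) j, nth 0 (0 :: s) j.+1] ->
        e t i = h t.
  move=> js J; have [h [hsm ch _]] := smooth_piece (csm j js).
  exists (fun t => segre k (h t) J) => [|t tj]; last by rewrite /e ch.
  apply: smooth_mul; first exact: hsm.
  by do 2![apply: smooth_bigprod => ?]; exact: hsm.
have eSV (t : R) : t \in `[0, 1] -> SV R n k (e t).
  by move=> /cpre ct; exists (c t).
have -> : curve_length (pre_metric k alpha) c =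
    curve_length (warped_metric alpha) e.
  have speedE j (t : R) : (j < size s)%N ->
      t \in `]nth 0 (0 :: s) j, nth 0 (0 :: s) j.+1[ ->
      Num.sqrt (pre_metric k alpha (c t) (velocity c t) (velocity c t)) =
      warped_speed alpha e t.
    move=> js tj; have [h [hsm ch vh]] := smooth_piece (csm j js).
    have nearj : \near t, t \in `]nth 0 (0 :: s) j, nth 0 (0 :: s) j.+1[.
      exact: near_in_itvoo.
    have dh (x : R) : vderive h x (velocity h x).
      by move=> i; exact: smooth_is_derive.
    have tj' := subset_itv_oo_cc tj.
    have t01 := itv_partition_sub s01 js tj'.
    rewrite /warped_speed vh//.
    rewrite (velocity_near (e := fun s => segre k (h s)) (vderive_segre (dh t))).
      rewrite /e ch// warped_metric_segre// -?ch//; first exact: cpre.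
      move=> i; rewrite ch//.
      apply: (vderive_usphere (c := fun s => direction (h s) i)).
        by move=> ?; exact: dh.
      near=> x; have xj : x \in `]nth 0 (0 :: s) j, nth 0 (0 :: s) j.+1[.
        by near: x.
      rewrite -ch ?(subset_itv_oo_cc xj)//.
      have [] // := cpre x; exact: itv_partition_sub s01 js (subset_itv_oo_cc xj).
    near=> x; have xj : x \in `]nth 0 (0 :: s) j, nth 0 (0 :: s) j.+1[.
      by near: x.
    by rewrite /e ch// (subset_itv_oo_cc xj).
  have me := warped_speed_measurable alpha k1 s01 esm eSV.
  rewrite /curve_length.
  have [|_ ->] := integral_itv_partition s01 (f := fun t =>
    Num.sqrt (pre_metric k alpha (c t) (velocity c t) (velocity c t)))
    (fun t => sqrtr_ge0 _).
    move=> j js; apply: eq_measurable_fun (me j js) => t; rewrite inE/= => tj.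
    by rewrite (speedE j).
  have [_ ->] := integral_itv_partition s01 (fun t => sqrtr_ge0 _) me.
  apply: eq_bigr => j _; apply: eq_integral => t; rewrite inE/= => tj.
  by rewrite (speedE j).
apply: ereal_inf_lbound; exists e => //; split=> //.
- by exists s.
- by rewrite /e c0.
- by rewrite /e c1.
Unshelve. all: by end_near. Qed.

End PiecewiseCurves.

(** * Geodesics of the pre-Segre--Veronese manifold *)

Section Geodesics.
Context {R : realType} {d : nat} {n k : 'I_d -> nat}.
Implicit Types p q : pre_index n -> R.

(** The directions run along great circles, all of them reaching q when the
    common parameter tau reaches 1. *)
Lemma dist_pre_SV_le_param (alpha : R) p q (r r' tau tau' : R -> R) (l : R) :
  (forall i, 2 <= n i)%N -> pre_SV R n p -> pre_SV R n q -> 0 <= l ->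
  smooth r -> smooth tau ->
  (forall t : R, is_derive t 1 r (r' t)) ->
  (forall t : R, is_derive t 1 tau (tau' t)) ->
  (forall t : R, t \in `[0, 1] -> 0 < r t) ->
  r 0 = scal p -> r 1 = scal q -> tau 0 = 0 -> tau 1 = 1 ->
  (forall t, r' t ^+ 2 + (alpha * r t) ^+ 2 * (Mdist k p q * tau' t) ^+ 2 =
     l ^+ 2) ->
  (dist_pre_SV k alpha p q <= l%:E)%E.
Proof.
move=> n2 [p0 p1] [q0 q1] l0 sr st dr dtau r_gt0 r0 r1 tau0 tau1 speed.
pose a i := angle (direction p i) (direction q i).
have wex i : exists w : 'I_(n i) -> R,
    [/\ usphere w, inner (direction p i) w = 0 &
     direction q i = (fun j => cos (a i) * direction p i j + sin (a i) * w j)].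
  pose j0 : 'I_(n i) := Ordinal (ltnW (n2 i)); pose j1 : 'I_(n i) := Ordinal (n2 i).
  exact: (@great_circle _ _ _ _ j0 j1).
pose w i := sval (cid (wex i)).
have w1 i : usphere (w i) by rewrite /w; case: cid => ? [].
have uw i : inner (direction p i) (w i) = 0 by rewrite /w; case: cid => ? [].
have qE i : direction q i =
    (fun j => cos (a i) * direction p i j + sin (a i) * w i j).
  by rewrite /w; case: cid => ? [].
have pp i : inner (direction p i) (direction p i) = 1 by apply/usphereE.
have ww i : inner (w i) (w i) = 1 by apply/usphereE.
pose c t : pre_index n -> R := fun x =>
  match x with
  | inl _ => r t
  | inr y => cos (a (tag y) * tau t) * p (inr y) +
             sin (a (tag y) * tau t) * w (tag y) (tagged y)
  end.
have dirc t i : direction (c t) i =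
  (fun j => cos (a i * tau t) * direction p i j + sin (a i * tau t) * w i j) by [].
pose v t : pre_index n -> R := fun x =>
  match x with
  | inl _ => r' t
  | inr y => - sin (a (tag y) * tau t) * (a (tag y) * tau' t) * p (inr y) +
             cos (a (tag y) * tau t) * (a (tag y) * tau' t) * w (tag y) (tagged y)
  end.
have dirv t i : direction (v t) i =
  (fun j => - sin (a i * tau t) * (a i * tau' t) * direction p i j +
    cos (a i * tau t) * (a i * tau' t) * w i j) by [].
have dc t : vderive c t (v t).
  case=> [u|y]; first exact: (dr t).
  have D := is_derive_add
    (is_derive_mul (is_derive_cos_mul (a (tag y)) (dtau t))
                   (is_derive_cst (p (inr y)) t 1))
    (is_derive_mul (is_derive_sin_mul (a (tag y)) (dtau t))
                   (is_derive_cst (w (tag y) (tagged y)) t 1)).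
  by apply: is_derive_eq D _; rewrite /= !mulr0 !addr0.
have velE t : velocity c t = v t.
  by apply/funext => x; exact: derive1_is_derive (dc t x).
have cs x : cos x ^+ 2 + sin x ^+ 2 = 1 :> R := cos2Dsin2 x.
apply: (@le_trans _ _ (curve_length (pre_metric k alpha) c)); last first.
  rewrite /curve_length.
  rewrite (eq_integral (fun=> l%:E)) => [|t _].
    by rewrite integral_unit_cst.
  congr (_%:E); rewrite velE -(ger0_norm l0) -sqrtr_sqr -(speed t).
  congr (Num.sqrt _); rewrite /pre_metric -expr2; congr (_ + _ * _).
  rewrite exprMn [Mdist k p q ^+ 2]sqr_sqrtr; last first.
    by apply: sumr_ge0 => i _; rewrite mulr_ge0 ?sqr_ge0.
  rewrite mulr_suml; apply: eq_bigr => i _; rewrite -mulrA; congr (_ * _).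
  rewrite dirv inner_lincombl !inner_lincombr pp ww uw (innerC (w i)) uw -/(a i).
  have := cs (a i * tau t); set x := cos _; set y := sin _ => xy.
  by rewrite -[RHS]mulr1 -[X in _ = _ * X]xy; ring.
apply: ereal_inf_lbound; exists c => //; split.
- exists [:: 1]; split; first exact/itv_partition1/ltr01.
  move=> j _ [u|y]; first by exists r.
  have [sc ss] := smooth_cos_sin (a (tag y)) st.
  have sm := smooth_add (smooth_mul sc (@smooth_cst R (p (inr y))))
    (smooth_mul ss (@smooth_cst R (w (tag y) (tagged y)))).
  by exists (fun t => cos (a (tag y) * tau t) * p (inr y) +
    sin (a (tag y) * tau t) * w (tag y) (tagged y)); first exact: sm.
- move=> t t01; split; first exact: r_gt0.
  move=> i; apply/usphereE; rewrite dirc inner_lincombl !inner_lincombr pp ww uw.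
  rewrite (innerC (w i)) uw -[RHS](cs (a i * tau t)).
  by ring.
- apply/funext => -[[]|[i j]]; first exact: r0.
  by rewrite /c /= tau0 mulr0 cos0 sin0 mul1r mul0r addr0.
- apply/funext => -[[]|[i j]]; first exact: r1.
  rewrite /c /= tau1 mulr1.
  by have := congr1 (fun f => f j) (qE i); rewrite /direction => ->.
Qed.

(** In the plane the geodesic is the segment from (la, 0) to the point with
    polar coordinates (mu, th). Measured along it from the foot of the
    perpendicular from the origin, at distance rho, the abscissa rho s gives the
    polar coordinates rho sqrt(1 + s^2) and atan s, which are smooth in s. *)
Lemma dist_pre_SV_le_cone_dist (alpha : R) p q :
  (forall i, 2 <= n i)%N -> 0 < alpha -> pre_SV R n p -> pre_SV R n q ->
  compatible k alpha p q ->
  (dist_pre_SV k alpha p q <=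
   (cone_dist (scal p) (scal q) (alpha * Mdist k p q))%:E)%E.
Proof.
move=> n2 alpha0 pP qP Mlt; have [la0 _] := pP; have [mu0 _] := qP.
set M := Mdist k p q; set th := alpha * M.
set la := scal p in la0 *; set mu := scal q in mu0 *.
have M0 : 0 <= M by exact: Mdist_ge0.
have thpi : th < pi by rewrite /th mulrC -ltr_pdivlMr.
have [thE|thN] := eqVneq th 0.
  have ME : M = 0 by move/eqP: thE; rewrite mulf_eq0 gt_eqF//= => /eqP.
  apply: (@dist_pre_SV_le_param alpha p q (fun t => la + (mu - la) * t)
    (fun=> mu - la) (fun t => t) (fun=> 1)) => //.
  - exact: sqrtr_ge0.
  - apply: smooth_add; first exact: smooth_cst.
    by apply: smooth_mul; [exact: smooth_cst|exact: smooth_id].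
  - exact: smooth_id.
  - move=> t; have D := is_derive_add (is_derive_cst la t 1)
      (is_derive_mul (is_derive_cst (mu - la) t 1) (is_derive_id t 1)).
    by apply: is_derive_eq D _; rewrite /=; ring.
  - move=> t; rewrite in_itv/= => /andP[t0 t1].
    have [->|t1'] := eqVneq t 1; first by rewrite mulr1; lra.
    have {t1 t1'} t1 : t < 1 by rewrite lt_neqAle t1'.
    rewrite (_ : _ + _ = la * (1 - t) + mu * t); last by ring.
    by rewrite ltr_wpDr ?mulr_gt0 ?mulr_ge0 ?subr_gt0 ?(ltW mu0).
  - by rewrite mulr0 addr0.
  - by rewrite mulr1 addrC subrK.
  - move=> t; rewrite -/M ME mul0r expr0n/= mulr0 addr0 thE /cone_dist cos0.
    rewrite sqr_sqrtr.
      by ring.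
    by rewrite (_ : _ + _ = (mu - la) ^+ 2) ?sqr_ge0//; ring.
have th0 : 0 < th by rewrite lt_neqAle eq_sym thN mulr_ge0// ltW.
set f := cone_dist la mu th.
pose co := cos th; pose si := sin th.
have si0 : 0 < si by rewrite sin_gt0_pi// th0.
have cs : co ^+ 2 + si ^+ 2 = 1 := cos2Dsin2 th.
have f2E : la ^+ 2 - 2 * la * mu * co + mu ^+ 2 =
    (mu * co - la) ^+ 2 + (mu * si) ^+ 2.
  have mu2 : mu ^+ 2 = mu ^+ 2 * (co ^+ 2 + si ^+ 2) by rewrite cs mulr1.
  by rewrite [X in _ + X = _]mu2; ring.
have f0 : 0 < f.
  rewrite /f /cone_dist -/co f2E sqrtr_gt0 ltr_wpDl ?sqr_ge0//.
  by rewrite exprn_gt0// mulr_gt0.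
have f2 : f ^+ 2 = la ^+ 2 - 2 * la * mu * co + mu ^+ 2.
  by rewrite /f /cone_dist -/co sqr_sqrtr// f2E addr_ge0 ?sqr_ge0.
(* s0 and s1 are the parameters of the end points, and del is their difference.
   The distance rho of the origin from the segment is the area la mu sin th of
   the parallelogram spanned by the end points, divided by the length f. *)
pose s0 := (mu * co - la) / (mu * si); pose s1 := (mu - la * co) / (la * si).
pose del := f ^+ 2 / (la * mu * si); pose rho := la * mu * si / f.
have laN : la != 0 by rewrite gt_eqF.
have muN : mu != 0 by rewrite gt_eqF.
have siN : si != 0 by rewrite gt_eqF.
have fN : f != 0 by rewrite gt_eqF.
have del0 : 0 < del by rewrite divr_gt0 ?exprn_gt0 ?mulr_gt0.
have rho0 : 0 < rho by rewrite divr_gt0 ?mulr_gt0.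
have s01 : s0 + del = s1.
  by rewrite /s0 /s1 /del f2; field; rewrite laN muN siN.
pose s t := s0 + del * t.
have ds (t : R) : is_derive t 1 s del.
  have D := is_derive_add (is_derive_cst s0 t 1)
    (is_derive_mul (is_derive_cst del t 1) (is_derive_id t 1)).
  by apply: is_derive_eq D _; rewrite /=; ring.
have ss : smooth s.
  apply: smooth_add; first exact: smooth_cst.
  by apply: smooth_mul; [exact: smooth_cst|exact: smooth_id].
have sW := smooth_cosatan ss.
have W0 : cosatan s 0 = mu * si / f.
  have h : 0 < mu * si / f by rewrite divr_gt0 ?mulr_gt0.
  rewrite /cosatan /s mulr0 addr0 -[RHS]invrK; congr (_^-1).
  rewrite -[RHS]ger0_norm ?invr_ge0 ?(ltW h)// -sqrtr_sqr; congr Num.sqrt.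
  rewrite /s0 invf_div !expr_div_n f2 f2E.
  by field; rewrite muN siN.
have W1 : cosatan s 1 = la * si / f.
  have h : 0 < la * si / f by rewrite divr_gt0 ?mulr_gt0.
  rewrite /cosatan /s mulr1 s01 -[RHS]invrK; congr (_^-1).
  rewrite -[RHS]ger0_norm ?invr_ge0 ?(ltW h)// -sqrtr_sqr; congr Num.sqrt.
  rewrite /s1 invf_div !expr_div_n f2.
  have -> : la ^+ 2 - 2 * la * mu * co + mu ^+ 2 =
      (mu - la * co) ^+ 2 + (la * si) ^+ 2.
    have la2 : la ^+ 2 = la ^+ 2 * (co ^+ 2 + si ^+ 2) by rewrite cs mulr1.
    by rewrite [X in X - _]la2; ring.
  by field; rewrite laN siN.
have total_angle : atan s1 - atan s0 = th.
  have s1E : s 1 = s1 by rewrite /s mulr1.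
  have s0E : s 0 = s0 by rewrite /s mulr0 addr0.
  have sin_atan x : sin (atan x) = x * cos (atan x) :> R.
    rewrite -[X in _ = X * _](atanK x) /tan divfK//.
    by rewrite cos_atan invr_eq0 gt_eqF// sqrtr_gt0; have := sqr_ge0 x; lra.
  have c0 : cos (atan s0) = mu * si / f by rewrite cos_atan -s0E -W0.
  have c1 : cos (atan s1) = la * si / f by rewrite cos_atan -s1E -W1.
  apply: cos_inj.
  - have := atan_gtNpi2 s0; have := atan_ltpi2 s1.
    have : atan s0 <= atan s1 by apply: le_atan; rewrite -s01 lerDl ltW.
    by rewrite in_itv/= => ? ? ?; apply/andP; split; lra.
  - by rewrite in_itv/= (ltW th0) ltW.
  rewrite cosB !sin_atan c0 c1 -/co.
  have -> : la * si / f * (mu * si / f) +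
      s1 * (la * si / f) * (s0 * (mu * si / f)) =
      (la * mu * si ^+ 2 + (mu - la * co) * (mu * co - la)) / f ^+ 2.
    by rewrite /s1 /s0; field; rewrite laN muN siN fN.
  have si2 : si ^+ 2 = 1 - co ^+ 2 by rewrite -cs; ring.
  have -> : la * mu * si ^+ 2 + (mu - la * co) * (mu * co - la) = co * f ^+ 2.
    by rewrite f2 si2; ring.
  by rewrite mulfK// expf_neq0.
have rho_del : rho * del = f by rewrite /rho /del; field; rewrite laN muN siN fN.
pose W := cosatan s.
have WW t : W t ^+ 2 * (1 + s t ^+ 2) = 1 := cosatan_sqr s t.
have Wgt0 t : 0 < W t := cosatan_gt0 s t.
have rE t : rho * ((1 + s t ^+ 2) * W t) = rho / W t.
  congr (_ * _); apply: (mulIf (lt0r_neq0 (Wgt0 t))).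
  by rewrite mulVf ?gt_eqF// -mulrA -expr2 mulrC WW.
have dr (t : R) : is_derive t 1 (fun t => rho * ((1 + s t ^+ 2) * W t))
    (rho * (s t * del * W t)).
  have Dsq : is_derive t 1 (fun t => 1 + s t ^+ 2) (2 * s t * del).
    have D := is_derive_add (is_derive_cst (1 : R) t 1)
      (is_derive_mul (ds t) (ds t)).
    by apply: is_derive_eq D _; ring.
  have D := is_derive_mul (is_derive_cst rho t 1)
    (is_derive_mul Dsq (is_derive_cosatan (ds t))).
  apply: is_derive_eq D _; rewrite /= mul0r add0r -/W; congr (_ * _).
  have -> : (1 + s t ^+ 2) * (- (s t * del) * W t ^+ 3) =
      - (s t * del) * W t * (W t ^+ 2 * (1 + s t ^+ 2)) by ring.
  by rewrite WW; ring.
have dtau (t : R) : is_derive t 1 (fun t => th^-1 * (atan (s t) - atan s0))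
    (th^-1 * (del * W t ^+ 2)).
  have Datan : is_derive t 1 (fun t => atan (s t)) _ :=
    @is_derive1_comp _ atan s t _ _ (is_derive1_atan (s t)) (ds t).
  have D := is_derive_mul (is_derive_cst th^-1 t 1)
    (is_derive_add Datan (is_derive_cst (- atan s0) t 1)).
  apply: is_derive_eq D _; rewrite /= mul0r add0r addr0; congr (_ * _).
  rewrite mulrC; congr (_ * _).
  by rewrite -[LHS]mul1r -[X in X / _](WW t) mulfK// gt_eqF// ltr_pwDl ?sqr_ge0.
have sr : smooth (fun t => rho * ((1 + s t ^+ 2) * W t)).
  exact: (smooth_mul (@smooth_cst R rho)
    (smooth_mul (smooth_add (@smooth_cst R 1) (smooth_mul ss ss)) sW)).
have stau' : smooth (fun t => th^-1 * (del * W t ^+ 2)).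
  exact: (smooth_mul (@smooth_cst R th^-1)
    (smooth_mul (@smooth_cst R del) (smooth_mul sW sW))).
have stau := smooth_of_derivative dtau stau'.
apply: (dist_pre_SV_le_param n2 pP qP (ltW f0) sr stau dr dtau).
- by move=> t _; rewrite rE divr_gt0.
- by rewrite rE /W W0 /rho -/la; field; rewrite ?muN ?siN ?fN.
- by rewrite rE /W W1 /rho -/mu; field; rewrite ?laN ?siN ?fN.
- by rewrite /s mulr0 addr0 subrr mulr0.
- by rewrite /s mulr1 s01 total_angle mulVf.
- move=> t; rewrite -/M -/th -/la -/mu -/f.
  have thM : M * th^-1 * alpha = 1 by rewrite mulrAC [M * _]mulrC mulfV.
  have -> : (alpha * (rho * ((1 + s t ^+ 2) * W t))) ^+ 2 *
      (M * (th^-1 * (del * W t ^+ 2))) ^+ 2 =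
      (M * th^-1 * alpha) ^+ 2 * (rho * del) ^+ 2 *
      (W t ^+ 2 * (1 + s t ^+ 2)) ^+ 2 * W t ^+ 2 by ring.
  rewrite thM WW !expr1n mulr1 mul1r rho_del.
  have -> : (rho * (s t * del * W t)) ^+ 2 = (rho * del) ^+ 2 * (s t * W t) ^+ 2.
    by ring.
  rewrite rho_del -mulrDr -[RHS]mulr1 -[X in _ = _ * X](WW t).
  by ring.
Qed.

End Geodesics.

Theorem proposition4p12 (R : realType) (d : nat) (n k : 'I_d -> nat)
    (alpha : R) (hd : (1 <= d)%N) (hn : forall i, (2 <= n i)%N)
    (hk : forall i, (1 <= k i)%N) (halpha : 0 < alpha)
    (P Q : tensor_index n k -> R) (hP : SV R n k P) (hQ : SV R n k Q)
    (p q : pre_index n -> R) (hm : matched P Q p q)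
    (hc : compatible k alpha p q) :
  dist_SV alpha P Q = dist_pre_SV k alpha p q.
Proof.
have [[pP pE] [qP qE] _] := hm.
apply/eqP; rewrite eq_le; apply/andP; split.
  by rewrite -pE -qE; exact: dist_SV_le_dist_pre_SV.
apply: (le_trans (dist_pre_SV_le_cone_dist hn halpha pP qP hc)).
exact: cone_dist_le_dist_SV.
Qed.
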